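(* Let $\mathbb{A}=\{a_1,\ldots,a_n\}$ be a list of integers with $1\le a_1\le\cdots\le a_n$. There is a 1-1 correspondence between the set of $\mathrm{lpp}_{\le}(\mathbb{A})$-vectors and the set of Hilbert functions of $\mathrm{lpp}_{\le}(\mathbb{A})$-ideals (that is, the set of sequences $H(R/I)$ with $I\subset R=k[x_1,\ldots,x_n]$ an $\mathrm{lpp}_{\le}(\mathbb{A})$-ideal), such that if the vector $\mathcal{T}$ corresponds to the Hilbert function $H$ then $\alpha_{\mathbb{A}}(\mathcal{T})=\alpha_{\mathbb{A}}(H)$ and $\sigma(\mathcal{T})=\sigma(H)$.
   Context: $k$ is a field, $R=k[x_1,\ldots,x_n]$ is standard graded, monomials are ordered lexicographically with $x_1>\cdots>x_n$. The Hilbert function of $R/I$ is the sequence $H(R/I)=\{\dim_k(R/I)_d\}_{d\ge 0}$. Lex plus powers ideals: for a non-decreasing list of positive integers $\mathbb{B}=\{b_1,\ldots,b_n\}$, a monomial ideal $L\subset R$ is a $\mathbb{B}$-lex plus powers ideal ($LPP(\mathbb{B})$) if it is minimally generated by monomials $x_1^{b_1},\ldots,x_n^{b_n},m_1,\ldots,m_l$ such that for each $j$ all monomials of degree $\deg(m_j)$ that are larger than $m_j$ in lex order lie in $L$. An $\mathrm{lpp}_{\le}(\mathbb{A})$-ideal is a lex plus powers ideal (for some list $\mathbb{B}$) containing $x_1^{a_1},\ldots,x_n^{a_n}$; equivalently, an $LPP(\mathbb{B})$ ideal with $b_i\le a_i$ for all $i$. For $H=H(R/I)$ with $I\supseteq\langle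 x_1^{a_1},\ldots,x_n^{a_n}\rangle$: $\alpha_{\mathbb{A}}(H)=\min\{i: H(i)<\dim_k(R/\langle x_1^{a_1},\ldots,x_n^{a_n}\rangle)_i\}$ ($=\infty$ if there is no such $i$), which is the least degree of an element of $I\setminus\langle x_1^{a_1},\ldots,x_n^{a_n}\rangle$; and $\sigma(H)=\min\{i: H(i)=0\}$. $\mathrm{lpp}_{\le}(\mathbb{A})$-vectors: write $\mathbb{A}_2=\{a_2,\ldots,a_n\}$. The vectors, their length $l$, the parameters $\sigma$ and $\alpha_{\mathbb{A}}$, and the special vector $\mathcal{T}_{c.i.(\mathbb{A})}$ are defined recursively on $n$. If $n=1$, an $\mathrm{lpp}_{\le}(\mathbb{A})$-vector is $\mathcal{T}=(d)$ with $d$ an integer, $1\le d\le a_1$; $\mathcal{T}_{c.i.(\mathbb{A})}=(a_1)$; $l(\mathcal{T})=\sigma(\mathcal{T})=d$; and $\alpha_{\mathbb{A}}(\mathcal{T})=d$ if $d<a_1$, $\alpha_{\mathbb{A}}(\mathcal{T})=\infty$ if $d=a_1$. If $n>1$, $\mathcal{T}=(\mathcal{T}_1,\ldots,\mathcal{T}_u)$ with $u\ge 1$ is an $\mathrm{lpp}_{\le}(\mathbb{A})$-vector if $u\le a_1$, $u\le l(\mathcal{T}_u)$, each $\mathcal{T}_i$ is an $\mathrm{lpp}_{\le}(\mathbb{A}_2)$-vector, and $\sigma(\mathcal{T}_i)<\alpha_{\mathbb{A}_2}(\mathcal{T}_{i+1})$ for $1\le i\le u-1$. Put $l(\mathcal{T})=u$.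 Put $\sigma(\mathcal{T})=\sigma(\mathcal{T}_u)$ if $\mathcal{T}_u\ne\mathcal{T}_{c.i.(\mathbb{A}_2)}$, and $\sigma(\mathcal{T})=\sigma(\mathcal{T}_u)+s-1$ if $\mathcal{T}_u=\mathcal{T}_{c.i.(\mathbb{A}_2)}$, where $s=\#\{i:\mathcal{T}_i=\mathcal{T}_u\}$. Put $\alpha_{\mathbb{A}}(\mathcal{T})=l(\mathcal{T})$ if $l(\mathcal{T})<a_1$, and $\alpha_{\mathbb{A}}(\mathcal{T})=l(\mathcal{T})+\alpha_{\mathbb{A}_2}(\mathcal{T}_1)-1$ if $l(\mathcal{T})=a_1$. Finally $\mathcal{T}=\mathcal{T}_{c.i.(\mathbb{A})}$ if $l(\mathcal{T})=a_1$ and every $\mathcal{T}_i=\mathcal{T}_{c.i.(\mathbb{A}_2)}$. *)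

(* Defs.v *)
From HB Require Import structures.
From mathcomp Require Import all_boot all_order all_algebra.
From mathcomp Require Import boolp classical_sets functions.
From mathcomp Require Import mpoly.

Set Implicit Arguments.
Unset Strict Implicit.
Unset Printing Implicit Defensive.

Import Order.TTheory GRing.Theory.

Local Open Scope ring_scope.
Local Open Scope classical_set_scope.

(* Throughout, the polynomial ring k[x_1, ..., x_N] is {mpoly k[n.+1]} with
   N = n + 1 >= 1, and the variable x_(i+1) is 'X_i for i : 'I_n.+1. *)

(* The minimum of {i | P i}, with None standing for infinity when it is empty. *)
Definition min_nat (P : pred nat) : option nat :=
  if pselect (exists i, P i) is left exP then Some (ex_minn exP) else None.

Section Ideals.
Variables (k : fieldType) (n : nat).
Local Notation R := {mpoly k[n.+1]}.

Definition ideal_span (s : seq R) : set R :=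
  [set p | exists c : 'I_(size s) -> R, p = \sum_(i < size s) c i * s`_i].

Definition minimal_generators (s : seq R) (I : set R) : Prop :=
  [/\ uniq s, I = ideal_span s
    & forall t : seq R, {subset t <= s} -> ideal_span t = I -> {subset s <= t}].

(* The subspace I_d = I `&` R_d of the space R_d of forms of degree d. For an
   ideal I there is exactly one V as below (see homog_partP); when there is
   none, xget returns the default value 0. *)
Definition homog_part (I : set R) (d : nat) : {vspace dhomog n.+1 k d} :=
  xget 0%VS
    [set V | forall p : dhomog n.+1 k d, p \in V <-> I (mpoly_of_dhomog p)].

Lemma homog_partP (s : seq R) (d : nat) (p : dhomog n.+1 k d) :
  p \in homog_part (ideal_span s) d <-> ideal_span s (mpoly_of_dhomog p).
Proof.
set I := ideal_span s.
have I0 : I 0 by exists (fun=> 0); rewrite big1 // => i _; rewrite mul0r.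
have IZD (a : k) (q r : R) : I q -> I r -> I (a *: q + r).
  move=> [c ->] [c' ->]; exists (fun i => a *: c i + c' i).
  rewrite scaler_sumr -big_split /=; apply: eq_bigr => i _.
  by rewrite mulrDl scalerAl.
pose inI (V : {vspace dhomog n.+1 k d}) :=
  forall q, q \in V -> I (mpoly_of_dhomog q).
pose P := fun m => `[< exists2 V, inI V & \dim V = m >].
have exP : exists m, P m.
  exists 0%N; apply/asboolP; exists 0%VS; last exact: dimv0.
  by move=> q; rewrite memv0 => /eqP ->.
have leP m : P m -> (m <= \dim {: dhomog n.+1 k d})%N.
  by move=> /asboolP[V _ <-]; apply/dimvS/subvf.
case: (ex_maxnP exP leP) => m /asboolP[V VI dimV] maxm.
suff VP : forall q, q \in V <-> I (mpoly_of_dhomog q).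
  rewrite /homog_part; case: xgetP => [W _ ->|] //.
  by move=> /(_ V).
move=> q; split=> [/VI //|Iq].
have /maxm : P (\dim (V + <[q]>)%VS).
  apply/asboolP; exists (V + <[q]>)%VS => // _ /memv_addP[v vV [_ /vlineP[a ->] ->]].
  by rewrite addrC linearP; apply: IZD => //; exact: VI.
rewrite -dimV => le; have /eqP -> : V == (V + <[q]>)%VS.
  by rewrite eqEdim addvSl.
by rewrite (subvP (addvSr _ _)) // memv_line.
Qed.

(* For a homogeneous ideal I, (R / I)_d is R_d / I_d. *)
Definition hilbert (I : set R) (d : nat) : nat :=
  (\dim {: dhomog n.+1 k d} - \dim (homog_part I d))%N.

(* The order on n.+1.-tuplelexi nat compares the exponents of x_1 first, so
   this is the lexicographic order with x_1 > x_2 > ... *)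
Definition lex_lt (m m' : 'X_{1..n.+1}) : bool :=
  ((m : n.+1.-tuplelexi nat) < (m' : n.+1.-tuplelexi nat))%O.

Definition pure_powers (B : n.+1.-tuple nat) : seq 'X_{1..n.+1} :=
  [seq (U_(i) *+ tnth B i)%MM | i <- enum 'I_n.+1].

Definition is_lpp (B : n.+1.-tuple nat) (L : set R) : Prop :=
  exists ms : seq 'X_{1..n.+1},
    minimal_generators
      [seq 'X_[k, m] : R | m <- pure_powers B ++ ms] L
    /\ forall m m' : 'X_{1..n.+1},
         m \in ms -> mdeg m' = mdeg m -> lex_lt m m' -> L 'X_[m'].

Definition is_lpp_le (A : n.+1.-tuple nat) (L : set R) : Prop :=
  (exists B : n.+1.-tuple nat,
     [/\ sorted leq B, all (leq 1) B & is_lpp B L])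
  /\ forall i : 'I_n.+1, L ('X_i ^+ tnth A i).

Definition ci_ideal (A : n.+1.-tuple nat) : set R :=
  ideal_span [seq 'X_i ^+ tnth A i | i <- enum 'I_n.+1].

Definition hilbert_alpha (A : n.+1.-tuple nat) (H : nat -> nat) : option nat :=
  min_nat (fun i => (H i < hilbert (ci_ideal A) i)%N).

End Ideals.

Definition hilbert_sigma (H : nat -> nat) : option nat :=
  min_nat (fun i => H i == 0%N).

(* Nested vectors of depth n + 1, for lists of n + 1 integers: integers for
   depth 1, and sequences of vectors of the previous depth otherwise. *)
Fixpoint nvec (n : nat) : eqType :=
  if n is n'.+1 then (seq (nvec n') : eqType) else (nat : eqType).

(* In the following recursive definitions A is the list a_1, ..., a_(n+1), so
   that head 0 A is a_1 and behead A is A_2. *)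

Fixpoint vec_ci (n : nat) (A : seq nat) : nvec n :=
  match n with
  | 0 => head 0%N A
  | n'.+1 => nseq (head 0%N A) (vec_ci n' (behead A))
  end.

Definition vec_len (n : nat) : nvec n -> nat :=
  match n with
  | 0 => fun d => d
  | n'.+1 => fun T => size T
  end.

(* vec_last A T is T_u for T = (T_1, ..., T_u), and vec_first A T is T_1; the
   default value only matters for the empty sequence, which is never an
   lpp_<=(A)-vector. *)
Definition vec_last (n : nat) (A : seq nat) (T : nvec n.+1) : nvec n :=
  last (vec_ci n (behead A)) T.

Definition vec_first (n : nat) (A : seq nat) (T : nvec n.+1) : nvec n :=
  head (vec_ci n (behead A)) T.

Fixpoint vec_sigma (n : nat) (A : seq nat) : nvec n -> nat :=
  match n with
  | 0 => fun d => d
  | n'.+1 => fun T =>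
      let Tu := vec_last A T in
      if Tu == vec_ci n' (behead A)
      then (vec_sigma (behead A) Tu + count_mem Tu T - 1)%N
      else vec_sigma (behead A) Tu
  end.

(* None stands for infinity. *)
Fixpoint vec_alpha (n : nat) (A : seq nat) : nvec n -> option nat :=
  match n with
  | 0 => fun d => if (d < head 0 A)%N then Some d else None
  | n'.+1 => fun T =>
      if (size T < head 0 A)%N then Some (size T)
      else omap (fun a => (size T + a - 1)%N)
             (vec_alpha (behead A) (vec_first A T))
  end.

Definition lt_option (s : nat) (a : option nat) : bool :=
  if a is Some a' then (s < a')%N else true.

Fixpoint is_lpp_vec (n : nat) (A : seq nat) : nvec n -> bool :=
  match n with
  | 0 => fun d => (1 <= d <= head 0 A)%N
  | n'.+1 => fun T =>
      [&& (1 <= size T <= head 0 A)%N,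
          (size T <= vec_len (vec_last A T))%N,
          all (is_lpp_vec (behead A)) T
        & sorted (fun T1 T2 : nvec n' =>
                    lt_option (vec_sigma (behead A) T1)
                              (vec_alpha (behead A) T2)) T]
  end.

(* Main.v *)
Require Import Defs.
From mathcomp Require Import all_boot all_order all_algebra zify.
From mathcomp Require Import boolp classical_sets functions.
From mathcomp Require Import mpoly.

Set Implicit Arguments.
Unset Strict Implicit.
Unset Printing Implicit Defensive.

Import GRing.Theory.
Local Open Scope classical_set_scope.

(** The proof replaces ideals by sets of exponent vectors. If a monomial ideal
contains the powers x_i^(a_i), its Hilbert function only depends on the
monomials of the box (exponent of x_i below a_i) that it contains; in degree d
it counts the monomials of the box that are missing. These monomials form a
subset of the box closed under multiplication ([upset]). Call such a set a lex
ideal ([lexideal]) when it avoids 1 and each of its degrees is an initial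
segment for the lexicographic order.

Vectors are the same thing as lex ideals. Cut a subset of the box by the
exponent e of x_1. A lex ideal has u <= a_1 slices which avoid 1, and all
later slices are full; the entry T_(u-e) of a vector encodes slice e
([vec_ideal]). The inequality between sigma of an entry and alpha of the next
one says exactly that, as soon as slice e contains a monomial of degree d, slice
e+1 contains every monomial of degree d-1. This is what being closed under
multiplication and lexicographic means for the pile of slices
([assemble_lexideal], [lexideal_next]). Hence, by induction on the number of
variables, a vector yields a lex ideal whose least degree is its alpha and whose
first full degree is its sigma ([vec_ideal_spec]), distinct vectors yield
distinct lex ideals ([vec_ideal_inj]), and every lex ideal comes from a vector
([vec_ideal_surj]). Since an initial segment is known from its cardinality, a
lex ideal is determined by its Hilbert function ([box_hilbert_lexideal_inj]).

It remains to see that the Hilbert functions of lex ideals of the box are those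
of the lex plus powers ideals containing the x_i^(a_i). A lex ideal of the box,
together with the monomials outside the box, is such an ideal: its minimal
generators are the pure powers x_i^(b_i) and monomials of the box, and the b_i
do not decrease because x_j^b in the ideal forces x_i^b in it for i < j
([monomial_ideal_lpp]). Conversely, a lex plus powers ideal with smaller
exponents b_i need not be lexicographic in the box, because nothing is asked of
x_i^(b_i). But it is a proper monomial ideal containing the x_i^(a_i), so it is
enough that every such ideal has the Hilbert function of a lex ideal of the box.
This is the theorem of Clements and Lindström ([clements_lindstrom]): replacing
each degree of an [upset] by the initial segment of the same size ([lexify])
gives an [upset] again.

Its proof is by induction on the number n of variables. For n = 2 it is a count
on antidiagonals. For n >= 3, among the sets with the given Hilbert function
choose the one which is lexicographically largest. By induction, lexifying the
slices of fixed j-th exponent gives another set with that Hilbert function, so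
these slices are already initial segments, for every j ([exists_compressed]).
For such a set M, with lexification L, let M_e and L_e be the slices of exponent
e in the last variable. Then |L_0| + ... + |L_(j-1)| <= |M_0| + ... + |M_(j-1)|
for all j ([slices_compare]). As the multiples of L in the next degree have
slices L_(e-1) for e > 0 and the multiples of L_0 for e = 0, they are not more
numerous than the elements of M in that degree. *)

(** * Exponent vectors, divisibility and the lexicographic order *)

Definition in_box (A m : seq nat) : bool := all2 ltn m A.

(** Divisibility of the monomials with these exponents. *)
Definition exp_le (s t : seq nat) : bool := all2 leq s t.

Definition lexlt (s t : seq nat) : bool := ((s : seqlexi nat) < t)%O.

Arguments in_box : simpl never.
Arguments exp_le : simpl never.
Arguments lexlt : simpl never.

Lemma in_box_cons a A x m : in_box (a :: A) (x :: m) = (x < a) && in_box A m.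
Proof. by []. Qed.

Lemma exp_le_cons x s y t : exp_le (x :: s) (y :: t) = (x <= y) && exp_le s t.
Proof. by []. Qed.

Lemma lexlt_cons x s y t :
  lexlt (x :: s) (y :: t) = (x < y) || (x == y) && lexlt s t.
Proof.
rewrite /lexlt Order.SeqLexiOrder.ltxi_cons !leEnat.
by case: ltngtP.
Qed.

Lemma lexlt_irr s : lexlt s s = false.
Proof. exact: Order.POrderTheory.ltxx. Qed.

Lemma lexlt_trans : transitive lexlt.
Proof. by move=> y x z; exact: Order.POrderTheory.lt_trans. Qed.

Lemma lexlt_total s t : s != t -> lexlt s t || lexlt t s.
Proof. by rewrite /lexlt; case: (Order.TotalTheory.ltgtP (s : seqlexi nat) t). Qed.

Lemma in_box_size A m : in_box A m -> size m = size A.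
Proof. by rewrite /in_box all2E => /andP[/eqP]. Qed.

Lemma exp_le_size s t : exp_le s t -> size s = size t.
Proof. by rewrite /exp_le all2E => /andP[/eqP]. Qed.

Lemma exp_le_refl s : exp_le s s.
Proof. by elim: s => // x s; rewrite exp_le_cons leqnn. Qed.

Lemma exp_le_sumn s t : exp_le s t -> sumn s <= sumn t.
Proof. by elim: s t => [|x s IH] [|y t] //= /andP[le /IH]; lia. Qed.

Lemma exp_le_in_box A s t : exp_le s t -> in_box A t -> in_box A s.
Proof.
elim: s t A => [|x s IH] [|y t] [|a A] //=;
    rewrite ?exp_le_cons ?in_box_cons => /andP[le_xy /IH{}IH] /andP[lt_ya /IH].
by rewrite (leq_ltn_trans le_xy lt_ya).
Qed.

Lemma exp_le_trans : transitive exp_le.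
Proof.
move=> t s u; elim: s t u => [|x s IH] [|y t] [|z u] //=;
    rewrite ?exp_le_cons ?in_box_cons => /andP[xy st] /andP[yz tu].
by rewrite (leq_trans xy yz) (IH t).
Qed.

Lemma exp_le_sumn_eq s t : exp_le s t -> sumn t <= sumn s -> s = t.
Proof.
elim: s t => [|x s IH] [|y t] //=; rewrite ?exp_le_cons ?in_box_cons => /andP[xy st] le.
have := exp_le_sumn st => le2; rewrite (IH t) //; last by lia.
by congr cons; lia.
Qed.

Lemma exp_le_lex s t : exp_le s t -> s != t -> lexlt s t.
Proof.
elim: s t => [|x s IH] [|y t] //=; rewrite ?exp_le_cons ?in_box_cons => /andP[xy st].
rewrite lexlt_cons eqseq_cons; have := IH t st.
by case: (ltngtP x y) xy => //= _ _; apply.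
Qed.

Lemma cover_between s t : exp_le s t -> sumn s < sumn t ->
  exists u, [/\ exp_le s u, exp_le u t & sumn u = (sumn s).+1].
Proof.
elim: s t => [|x s IH] [|y t] //=; rewrite ?exp_le_cons ?in_box_cons => /andP[xy st] lt.
case: (ltnP x y) => xy'.
  by exists (x.+1 :: s); rewrite /= ?exp_le_cons exp_le_refl xy' st leqnSn addSn.
have [|u [su ut du]] := IH t st; first by lia.
by exists (x :: u); rewrite /= ?exp_le_cons leqnn xy su ut; split=> //; lia.
Qed.

Lemma cover_below t : 0 < sumn t ->
  exists s, exp_le s t /\ sumn t = (sumn s).+1.
Proof.
elim: t => //= -[|y] t IH.
  by case/IH=> s [st ds]; exists (0 :: s).
by exists (y :: t); rewrite /= ?exp_le_cons exp_le_refl leqnSn.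
Qed.

(** If no multiple of x^s by a variable stays in the box, then x^s is the socle
monomial of the box, and the only one of its degree or more. *)
Lemma cover_above A s t : in_box A s -> in_box A t -> sumn s <= sumn t ->
  t = s \/ exists u, [/\ in_box A u, exp_le s u & sumn u = (sumn s).+1].
Proof.
elim: A s t => [|a A IH] [|x s] [|y t] //=; first by left.
rewrite !in_box_cons => /andP[xa sA] /andP[ya tA] le.
case: (ltnP x y) => xy.
  right; exists (x.+1 :: s); rewrite /= ?in_box_cons ?exp_le_cons exp_le_refl leqnSn sA
      addSn; split=> //.
  by rewrite andbT; lia.
have [|ts|[u [uA su du]]] := IH s t sA tA; first by lia.
  by left; rewrite ts in le *; congr cons; lia.
by right; exists (x :: u); rewrite /= ?in_box_cons ?exp_le_cons xa uA su leqnn;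
    split=> //; lia.
Qed.

(** A variable other than the one multiplied keeps its exponent; this is why the
compression argument needs three variables. *)
Lemma cover_share s t : exp_le s t -> sumn t = (sumn s).+1 -> 1 < size s ->
  exists2 j, j < size s & nth 0 s j = nth 0 t j.
Proof.
move=> st dt sz; have := exp_le_size st; move: sz st dt;
    case: s t => [|x [|x' s]] [|y [|y' t]] //= _.
rewrite !exp_le_cons => /and3P[xy xy' st] dt _.
have le := exp_le_sumn st.
case: (ltngtP x y) xy => // [lt|eq] _; last by exists 0.
by exists 1 => //=; lia.
Qed.

(** The multiples of a lexicographic segment by the variables form a segment: a
monomial u beyond a multiple t of s is a multiple of some v which is s or beyond
it. One removes from u the last variable that occurs in it. *)
Lemma lex_predecessor s t u : exp_le s t -> sumn t = (sumn s).+1 ->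
    size u = size t -> sumn u = sumn t -> lexlt t u ->
  exists v, [/\ exp_le v u, sumn u = (sumn v).+1 & v = s \/ lexlt s v].
Proof.
elim: s t u => [|x s IH] [|y t] [|z u] //=;
    rewrite ?exp_le_cons ?in_box_cons => /andP[xy st] dt [sz] du.
rewrite lexlt_cons; case: (ltngtP y z) => //= [yz _|yz]; last first.
  move: du; rewrite -{}yz => {z} du.
  move=> tu; have := exp_le_sumn st => le.
  case: (ltngtP x y) xy => // [lt|eq] _; last first.
    have [||v [vu dv sv]] := IH t u st _ sz _ tu; try lia.
    exists (y :: v); rewrite /= ?exp_le_cons leqnn; split=> //; first by lia.
    by rewrite eq lexlt_cons eqxx ltnn; case: sv => [->|]; [left|right].
  have {}st : s = t by apply: exp_le_sumn_eq st _; lia.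
  exists (x :: u); rewrite /= ?exp_le_cons exp_le_refl ltnW //; split=> //; first by lia.
  by right; rewrite lexlt_cons ltnn eqxx st.
have [u0|u_gt0] := posnP (sumn u).
  exists (z.-1 :: u); rewrite /= ?exp_le_cons exp_le_refl leq_pred; split=> //;
      first by lia.
  rewrite lexlt_cons; have [lt|le] := ltnP x z.-1; first by right.
  have s0 : sumn s = 0 by lia.
  suff -> : s = u by left; congr cons; lia.
  apply: exp_le_sumn_eq; rewrite ?u0 // /exp_le.
  have sz' : size s = size u by rewrite (exp_le_size st).
  clear -s0 sz' u0; elim: s u sz' s0 u0 => [|a s IH] [|b u] //= [sz] s0 u0.
  by rewrite IH //; lia.
have [v [vu dv]] := cover_below u_gt0.
by exists (z :: v); rewrite /= ?exp_le_cons leqnn vu; split=> //; [lia|right;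
    rewrite lexlt_cons; lia].
Qed.

(** Multiplying s by a variable as far down the list as possible does not jump over
a larger t of higher degree. *)
Lemma lex_successor A s t : in_box A s -> in_box A t -> sumn s < sumn t ->
    lexlt s t ->
  exists u, [/\ in_box A u, exp_le s u, sumn u = (sumn s).+1 & u = t \/ lexlt u t].
Proof.
elim: A s t => [|a A IH] [|x s] [|y t] //=;
    rewrite ?exp_le_cons ?in_box_cons => /andP[xa sA] /andP[ya tA] lt.
rewrite lexlt_cons; case: (ltngtP x y) => //= [xy _|xy].
  have [xy'|xy'] := ltnP x.+1 y.
    exists (x.+1 :: s); rewrite /= ?in_box_cons ?exp_le_cons leqnSn exp_le_refl sA
        addSn lexlt_cons xy'.
    by split=> //; try lia; right.
  have [|->|[u [uA su du]]] := cover_above sA tA; first by lia.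
    exists (y :: s); rewrite /= ?in_box_cons ?exp_le_cons (ltnW xy) exp_le_refl sA ya;
        split=> //; first by lia.
    by left.
  exists (x :: u); rewrite /= ?in_box_cons ?exp_le_cons xa uA leqnn su lexlt_cons xy;
      split=> //; first by lia.
  by right.
subst y; move=> st; have [|u [uA su du ut]] := IH s t sA tA _ st; first by lia.
exists (x :: u); rewrite /= ?in_box_cons ?exp_le_cons xa uA leqnn su lexlt_cons eqxx ltnn.
by split=> //; [rewrite du addnS|case: ut => [->|]; [left|right]].
Qed.

Lemma lexlt_rcons s x t y : size s = size t ->
  lexlt (rcons s x) (rcons t y) = lexlt s t || (s == t) && (x < y).
Proof.
elim: s t => [|a s IH] [|b t] //= => [_|[sz]].
  by rewrite lexlt_cons !lexlt_irr andbF orbF.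
by rewrite !lexlt_cons IH // eqseq_cons; case: ltngtP => //= <-.
Qed.

Lemma exp_le_nthP s t : size s = size t ->
  reflect (forall i, i < size s -> nth 0 s i <= nth 0 t i) (exp_le s t).
Proof.
move=> sz; apply: (iffP idP) => [st i|].
  elim: s t i sz st => [|x s IH] [|y t] // [|i] [sz];
      rewrite exp_le_cons => /andP[xy st] //=.
  by rewrite ltnS; apply: IH.
elim: s t sz => [|x s IH] [|y t] //= [sz] H; rewrite exp_le_cons (H 0) //=.
by apply: IH => // i; exact: (H i.+1).
Qed.

Lemma in_box_nthP A m : size m = size A ->
  reflect (forall i, i < size A -> nth 0 m i < nth 0 A i) (in_box A m).
Proof.
move=> sz; apply: (iffP idP) => [mA i|].
  elim: A m i sz mA => [|a A IH] [|x m] // [|i] [sz];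
      rewrite in_box_cons => /andP[xa mA] //=.
  by rewrite ltnS; apply: IH.
elim: A m sz => [|a A IH] [|x m] //= [sz] H; rewrite in_box_cons (H 0) //=.
by apply: IH => // i; exact: (H i.+1).
Qed.

Lemma lexlt_nth i s t : size s = size t -> i < size s ->
  (forall j, j < i -> nth 0 s j = nth 0 t j) -> nth 0 s i < nth 0 t i -> lexlt s t.
Proof.
elim: s t i => [|x s IH] [|y t] // i [sz]; rewrite lexlt_cons.
case: i => [|i] is_ /= H lt; first by rewrite lt.
have /= -> := H 0 isT; rewrite eqxx ltnn /=; apply: (IH t i) => // j ji.
by exact: (H j.+1).
Qed.

(** * Lexicographic segments of a box and lexification *)

(** This enumeration of the box only serves to count. *)
Fixpoint box (A : seq nat) : seq (seq nat) :=
  if A is a :: A' then [seq e :: m | e <- iota 0 a, m <- box A'] else [:: [::]].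

Lemma mem_box A m : (m \in box A) = in_box A m.
Proof.
elim: A m => [|a A IH] [|x m] //=.
  by rewrite /in_box /=; apply/negbTE/negP => /allpairsP[[e m] /= [_ _]].
apply/idP/idP => [/allpairsP[[e m']] /= [] + + [-> ->]|].
  by rewrite mem_iota IH in_box_cons => /= -> ->.
by rewrite in_box_cons -IH => /andP[lt mA]; apply/allpairsP; exists (x, m);
    rewrite mem_iota.
Qed.

Lemma box_uniq A : uniq (box A).
Proof.
elim: A => //= a A IH; apply: allpairs_uniq; rewrite ?iota_uniq //.
by move=> [x m] [y m'] _ _ /= [-> ->].
Qed.

Definition lexsort (L : seq (seq nat)) : seq (seq nat) :=
  sort (fun s t : seqlexi nat => (t <= s)%O) L.

Lemma index_lexsort L : {in L &, forall s t,
  lexlt s t -> index t (lexsort L) < index s (lexsort L)}.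
Proof.
move=> s t sL tL st; rewrite ltnNge; apply/negP => le.
have tr : transitive (fun s t : seqlexi nat => (t <= s)%O).
  by move=> y x z /= xy yz; exact: Order.POrderTheory.le_trans yz xy.
have so : sorted (fun s t : seqlexi nat => (t <= s)%O) (lexsort L).
  by apply: sort_sorted => x y; case: (Order.TotalTheory.ltgtP (x : seqlexi nat) y).
have := @sorted_leq_index _ _ tr (@Order.POrderTheory.lexx _ _) _ so s t.
rewrite !mem_sort => /(_ sL tL le); rewrite Order.POrderTheory.le_eqVlt.
case/orP=> [/eqP ets|lt]; first by rewrite ets lexlt_irr in st.
by have := lexlt_trans st lt; rewrite lexlt_irr.
Qed.

(** The monomials of degree d in the box, largest first, so that lexicographic
segments are prefixes. *)
Definition layer (A : seq nat) (d : nat) : seq (seq nat) :=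
  lexsort [seq m <- box A | sumn m == d].

Lemma mem_layer A d m : (m \in layer A d) = in_box A m && (sumn m == d).
Proof. by rewrite mem_sort mem_filter mem_box andbC. Qed.

Lemma layer_uniq A d : uniq (layer A d).
Proof. by rewrite sort_uniq filter_uniq ?box_uniq. Qed.

Lemma count_layer P A d :
  count P (layer A d) = count (fun m => (sumn m == d) && P m) (box A).
Proof.
rewrite /layer (permP (permEl (perm_sort _ _))) count_filter.
by apply: eq_count => m /=; rewrite andbC.
Qed.

Lemma layer_lex A d : {in layer A d &, forall s t,
  lexlt s t -> index t (layer A d) < index s (layer A d)}.
Proof. by move=> s t; rewrite !mem_sort; exact: index_lexsort. Qed.

Definition lex_initial (A : seq nat) (d : nat) (P : pred (seq nat)) : Prop :=
  {in layer A d &, forall s t, lexlt s t -> P s -> P t}.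

Lemma count_le_in (T : eqType) (s : seq T) (P Q : pred T) :
  {in s, forall x, P x -> Q x} -> count P s <= count Q s.
Proof.
elim: s => //= x s IH PQ; apply: leq_add.
  by have := PQ x (mem_head _ _); case: (P x) => // ->.
by apply: IH => y ys; apply: PQ; rewrite inE ys orbT.
Qed.

Lemma count_lt_in (T : eqType) (s : seq T) (P Q : pred T) m :
  {in s, forall x, P x -> Q x} -> m \in s -> Q m -> ~~ P m ->
  count P s < count Q s.
Proof.
elim: s => //= x s IH PQ; rewrite inE.
have PQs : {in s, forall x, P x -> Q x} by move=> y ys; apply: PQ; rewrite inE ys orbT.
case/predU1P => [->|ms] Qm nPm.
  by rewrite Qm (negPf nPm) ltnS count_le_in.
by have := IH PQs ms Qm nPm; have := PQ x (mem_head _ _); case: (P x) => [->|]; lia.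
Qed.

(** Two initial segments of one degree are nested, so comparing them amounts to
comparing cardinals. *)
Lemma lex_initial_nested A d P Q : lex_initial A d P -> lex_initial A d Q ->
    count P (layer A d) <= count Q (layer A d) ->
  {in layer A d, forall m, P m -> Q m}.
Proof.
move=> iP iQ le m mA Pm; apply: contraT => nQm.
suff : count Q (layer A d) < count P (layer A d) by rewrite ltnNge le.
apply: (@count_lt_in _ _ _ _ m) => // x xA Qx.
have xm : x != m by apply: contraNneq nQm => <-.
case/orP: (lexlt_total xm) => lt; last exact: iP lt _.
by move: nQm; rewrite (iQ _ _ xA mA lt).
Qed.

Lemma lex_initial_eq A d P Q : lex_initial A d P -> lex_initial A d Q ->
    count P (layer A d) = count Q (layer A d) ->
  {in layer A d, P =1 Q}.
Proof.
move=> iP iQ eq m mA; apply/idP/idP.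
  by apply: (lex_initial_nested iP iQ); rewrite ?eq.
by apply: (lex_initial_nested iQ iP); rewrite ?eq.
Qed.

(** In each degree, the initial segment with as many elements as M. *)
Definition lexify (A : seq nat) (M : pred (seq nat)) : pred (seq nat) :=
  fun m => let L := layer A (sumn m) in index m L < count M L.

Lemma lexifyE A M d m : m \in layer A d ->
  lexify A M m = (index m (layer A d) < count M (layer A d)).
Proof. by rewrite mem_layer /lexify => /andP[_ /eqP ->]. Qed.

Lemma lex_initial_lexify A M d : lex_initial A d (lexify A M).
Proof.
move=> s t sA tA st; rewrite !(@lexifyE _ _ d) //; apply: ltn_trans.
exact: layer_lex.
Qed.

Lemma count_index (T : eqType) (s : seq T) k : uniq s -> k <= size s ->
  count (fun x => index x s < k) s = k.
Proof.
move=> us le; rewrite -[RHS](size_takel le) -(@count_predT _ (take k s)).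
rewrite -[in LHS](cat_take_drop k s) count_cat.
rewrite (@eq_in_count _ _ predT (take k s)); last first.
  by move=> x xs /=; rewrite cat_take_drop -in_take ?(mem_take xs).
rewrite [X in _ + X](_ : _ = 0) ?addn0 //.
apply/eqP; rewrite -leqn0 -ltnS ltnNge -has_count; apply/hasPn => x xs.
rewrite cat_take_drop -in_take ?(mem_drop xs) //.
by move: us; rewrite -[s in uniq s](cat_take_drop k s) cat_uniq =>
    /and3P[_ /hasPn H _]; apply: H.
Qed.

Lemma count_lexify A M d :
  count (lexify A M) (layer A d) = count M (layer A d).
Proof.
rewrite (@eq_in_count _ _ (fun m => index m (layer A d) < count M (layer A d))).
  by rewrite count_index ?layer_uniq ?count_size.
by move=> m; exact: lexifyE.
Qed.

(** The exponents, within the box, of a monomial ideal which contains the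
x_i^(a_i). *)
Definition upset (A : seq nat) (M : pred (seq nat)) : Prop :=
  forall s t, in_box A t -> exp_le s t -> M s -> M t.

Lemma upset_cover A (M : pred (seq nat)) :
  (forall s t, in_box A t -> exp_le s t -> sumn t = (sumn s).+1 -> M s -> M t) ->
  upset A M.
Proof.
move=> H s t; move: {2}(sumn t - sumn s) (erefl (sumn t - sumn s)) => k.
elim: k s => [|k IH] s Ek tA st Ms.
  by rewrite -(exp_le_sumn_eq st) //; lia.
have [|u [su ut du]] := cover_between st; first by lia.
by apply: (IH u) => //; [lia|apply: (H s) => //; exact: exp_le_in_box ut tA].
Qed.

(** The conclusion of the Clements-Lindström theorem for the box A. *)
Definition lexifiable (A : seq nat) : Prop :=
  forall M, upset A M -> upset A (lexify A M).

Lemma lex_initial_shadow A d P : lex_initial A d P ->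
  lex_initial A d.+1 (fun t => has (fun s => P s && exp_le s t) (layer A d)).
Proof.
move=> iP t u; rewrite !mem_layer => /andP[tA /eqP dt] /andP[uA /eqP du] tu.
case/hasP => s; rewrite mem_layer => /andP[sA /eqP ds] /andP[Ps st].
have [|||v [vu dv sv]] := lex_predecessor st _ _ _ tu; rewrite ?ds ?dt ?du //.
  by rewrite (in_box_size uA) (in_box_size tA).
have vL : v \in layer A d by rewrite mem_layer (exp_le_in_box vu) //=; lia.
apply/hasP; exists v => //; rewrite vu andbT.
case: sv => [->//|sv]; apply: iP sv Ps => //.
by rewrite mem_layer sA ds eqxx.
Qed.

(** Both the multiples of the segment in degree d and the segment in degree d+1
are initial, so it is enough that the former are not more numerous. *)
Lemma lexify_upset A M :
  (forall d, count (fun t => has (fun s => lexify A M s && exp_le s t) (layer A d))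
               (layer A d.+1) <= count M (layer A d.+1)) ->
  upset A (lexify A M).
Proof.
move=> H; apply: upset_cover => s t tA st dt Ms.
have := H (sumn s); rewrite -[X in _ <= X](count_lexify A) => le.
have sA := exp_le_in_box st tA.
apply: (lex_initial_nested (lex_initial_shadow (@lex_initial_lexify A M _))
  (@lex_initial_lexify A M _) le); first by rewrite mem_layer tA dt eqxx.
by apply/hasP; exists s; rewrite ?mem_layer ?sA ?eqxx // Ms.
Qed.

Lemma initial_lexify_upset A M : upset A M -> (forall d, lex_initial A d M) ->
  upset A (lexify A M).
Proof.
move=> uM iM s t tA st; have sA := exp_le_in_box st tA.
have E m : in_box A m -> lexify A M m = M m.
  move=> mA; apply: (@lex_initial_eq A (sumn m)); rewrite ?count_lexify //.
    exact: lex_initial_lexify.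
  by rewrite mem_layer mA eqxx.
by rewrite !E //; exact: uM.
Qed.

(** * Slices by one exponent and compression *)

(** A monomial in one more variable, of exponent e, placed at position i. *)
Definition insert_at (i e : nat) (m : seq nat) : seq nat := take i m ++ e :: drop i m.

Definition delete_at (i : nat) (s : seq nat) : seq nat := take i s ++ drop i.+1 s.

Arguments insert_at : simpl never.
Arguments delete_at : simpl never.

Lemma size_insert_at i e m : size (insert_at i e m) = (size m).+1.
Proof. by rewrite size_cat /= addnS -size_cat cat_take_drop. Qed.

Lemma size_delete_at i s : i < size s -> (size (delete_at i s)).+1 = size s.
Proof. by move=> lt; rewrite size_cat size_takel ?(ltnW lt) // size_drop; lia. Qed.

Lemma sumn_insert_at i e m : sumn (insert_at i e m) = e + sumn m.
Proof. by rewrite sumn_cat /= -{3}[m](cat_take_drop i) sumn_cat addnCA. Qed.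

Lemma nth_insert_at i e m : i <= size m -> nth 0 (insert_at i e m) i = e.
Proof. by move=> le; rewrite nth_cat size_takel // ltnn subnn. Qed.

Lemma insert_at0 e m : insert_at 0 e m = e :: m.
Proof. by rewrite /insert_at take0 drop0. Qed.

Lemma insert_atS i e x m : insert_at i.+1 e (x :: m) = x :: insert_at i e m.
Proof. by []. Qed.

Lemma delete_at0 x m : delete_at 0 (x :: m) = m.
Proof. by rewrite /delete_at /= drop0. Qed.

Lemma delete_atS i x m : delete_at i.+1 (x :: m) = x :: delete_at i m.
Proof. by []. Qed.

Lemma delete_at_insert_at i e m : i <= size m -> delete_at i (insert_at i e m) = m.
Proof.
by elim: i m => [|i IH] [|x m] // le;
    rewrite ?insert_at0 ?insert_atS ?delete_at0 ?delete_atS ?IH.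
Qed.

Lemma insert_at_delete_at i s : i < size s -> insert_at i (nth 0 s i) (delete_at i s) = s.
Proof.
by elim: i s => [|i IH] [|x s] // lt;
    rewrite ?delete_at0 ?insert_at0 ?delete_atS ?insert_atS //= IH.
Qed.

Lemma insert_at_last e m : insert_at (size m) e m = rcons m e.
Proof. by rewrite /insert_at take_size drop_size cats1. Qed.

Lemma insert_at_nil i e : insert_at i e [::] = [:: e].
Proof. by case: i. Qed.

Lemma in_box_insert_at i a A e m : size m = size A ->
  in_box (insert_at i a A) (insert_at i e m) = (e < a) && in_box A m.
Proof.
elim: i A m => [|i IH] [|b A] [|x m] //= sz;
    rewrite ?insert_at0 ?insert_at_nil ?insert_atS ?in_box_cons //.
by rewrite IH; [rewrite andbCA|case: sz].
Qed.

Lemma exp_le_insert_at i e s f t : size s = size t ->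
  exp_le (insert_at i e s) (insert_at i f t) = (e <= f) && exp_le s t.
Proof.
elim: i s t => [|i IH] [|x s] [|y t] //= sz;
    rewrite ?insert_at0 ?insert_at_nil ?insert_atS ?exp_le_cons //.
by rewrite IH; [rewrite andbCA|case: sz].
Qed.

Lemma lexlt_insert_at i e s t : size s = size t ->
  lexlt (insert_at i e s) (insert_at i e t) = lexlt s t.
Proof.
elim: i s t => [|i IH] [|x s] [|y t] //= sz;
    rewrite ?insert_at0 ?insert_atS ?lexlt_cons ?eqxx ?ltnn ?lexlt_irr //.
by rewrite IH; case: sz.
Qed.

Lemma in_box_insert_atP i a A s : i <= size A -> in_box (insert_at i a A) s ->
  exists e m, [/\ s = insert_at i e m, e < a & in_box A m].
Proof.
move=> le sA; have sz := in_box_size sA; rewrite size_insert_at in sz.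
exists (nth 0 s i), (delete_at i s); rewrite insert_at_delete_at ?sz //.
move: sA; rewrite -{1}[s](@insert_at_delete_at i) ?sz // in_box_insert_at; last first.
  by apply: succn_inj; rewrite size_delete_at sz.
by case/andP.
Qed.

Definition slice_count i P A d e :=
  if e <= d then count (fun m => P (insert_at i e m)) (layer A (d - e)) else 0.

(** A degree of the box is the disjoint union of its slices of exponent e in the
i-th variable; the truncated difference d - e is guarded in [slice_count]. *)
Lemma count_slices i a A P d : i <= size A ->
  count P (layer (insert_at i a A) d) = \sum_(0 <= e < a) slice_count i P A d e.
Proof.
move=> le; rewrite count_layer.
have /permP -> : perm_eq (box (insert_at i a A)) [seq insert_at i e m | e <- iota 0 a,
    m <- box A].
  apply: uniq_perm; first exact: box_uniq.
    apply: allpairs_uniq; rewrite ?iota_uniq ?box_uniq //.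
    move=> [e m] [f u] /allpairsP[[e1 m1] [/= _ mA [-> ->]]].
    move=> /allpairsP[[f1 u1] [/= _ uA [-> ->]]] /= eq.
    rewrite !mem_box in mA uA; have [mz uz] := (in_box_size mA, in_box_size uA).
    rewrite -[m1](@delete_at_insert_at i e1) ?mz // -[u1](@delete_at_insert_at i f1)
        ?uz // eq.
    by congr pair; rewrite -[e1](@nth_insert_at i e1 m1) ?mz // eq nth_insert_at ?uz.
  move=> s; rewrite mem_box; apply/idP/allpairsP => [|[[e m] /= [+ + ->]]].
    by case/in_box_insert_atP => // e [m [-> lt mA]]; exists (e, m);
        rewrite mem_iota mem_box.
  by rewrite mem_iota mem_box => /= lt mA;
      rewrite in_box_insert_at ?lt // (in_box_size mA).
rewrite count_flatten sumnE !big_map /index_iota subn0; apply: eq_bigr => e _.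
rewrite count_map /slice_count; case: leqP => ed.
  rewrite count_layer; apply: eq_count => m /=; rewrite sumn_insert_at; congr andb.
  by apply/eqP/eqP; lia.
by apply/eqP; rewrite -leqn0 leqNgt -has_count; apply/hasPn => m _ /=;
    rewrite sumn_insert_at; lia.
Qed.

(** Lexification inside each slice of fixed i-th exponent; the box of the other
variables is A. *)
Definition compress (i : nat) (A : seq nat) (M : pred (seq nat)) : pred (seq nat) :=
  fun s => lexify A (fun m => M (insert_at i (nth 0 s i) m)) (delete_at i s).

Lemma compress_insert_at i A M e m : i <= size m ->
  compress i A M (insert_at i e m) = lexify A (fun m => M (insert_at i e m)) m.
Proof. by move=> le; rewrite /compress nth_insert_at // delete_at_insert_at. Qed.

Lemma slice_count_compress i A M d e : i <= size A ->
  slice_count i (compress i A M) A d e = slice_count i M A d e.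
Proof.
move=> le; rewrite /slice_count; case: ifP => // _.
rewrite -[RHS]count_lexify; apply: eq_in_count => m; rewrite mem_layer => /andP[mA _].
by rewrite compress_insert_at // (in_box_size mA).
Qed.

Lemma count_compress i a A M d : i <= size A ->
  count (compress i A M) (layer (insert_at i a A) d) = count M (layer (insert_at i a A)
      d).
Proof.
by move=> le; rewrite !count_slices //; apply: eq_bigr => e _;
    rewrite slice_count_compress.
Qed.

(** Multiplication inside a slice is handled by the hypothesis on the smaller box;
multiplication by the i-th variable embeds a slice in the next one, hence also
their lexifications, by cardinality. *)
Lemma compress_upset i a A M : i <= size A -> lexifiable A ->
  upset (insert_at i a A) M -> upset (insert_at i a A) (compress i A M).
Proof.
move=> le LA uM s t tA st; have sA := exp_le_in_box st tA.
have [e [m [es ea mA]]] := in_box_insert_atP le sA;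
    have [f [u [et fa uA]]] := in_box_insert_atP le tA.
have sz : size m = size u by rewrite (in_box_size mA) (in_box_size uA).
subst s t; move: st; rewrite exp_le_insert_at // => /andP[ef mu].
rewrite !compress_insert_at ?(in_box_size mA, in_box_size uA) // => Hm.
have {}Hm : lexify A (fun m => M (insert_at i e m)) u.
  apply: (LA _ _ m u uA mu Hm) => v w wA vw; apply: uM.
    by rewrite in_box_insert_at ?ea // (in_box_size wA).
  by rewrite exp_le_insert_at ?leqnn // (exp_le_size vw).
apply: leq_trans Hm _; apply: count_le_in => v; rewrite mem_layer => /andP[vA _].
apply: uM; first by rewrite in_box_insert_at ?fa // (in_box_size vA).
by rewrite exp_le_insert_at // ef exp_le_refl.
Qed.

(** Stability under lexification in all slices at once: going up in the order is
allowed between monomials of one degree which share some exponent. *)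
Definition compressed (A : seq nat) (M : pred (seq nat)) : Prop :=
  forall s t, in_box A s -> in_box A t -> sumn s = sumn t -> lexlt s t ->
    (exists2 j, j < size A & nth 0 s j = nth 0 t j) -> M s -> M t.

(** The characteristic word of M along L, read as a binary number: if L is sorted
then the weight compares sets by the largest element on which they differ. *)
Fixpoint lex_weight (L : seq (seq nat)) (M : pred (seq nat)) : nat :=
  if L is x :: L' then M x * 2 ^ size L' + lex_weight L' M else 0.

Lemma lex_weight_lt L M : lex_weight L M < 2 ^ size L.
Proof. by elim: L => //= x L IH; rewrite expnS; case: (M x); lia. Qed.

Lemma lex_weight_le L (M M' : pred (seq nat)) :
    {in L, forall x, M x -> ~~ M' x ->
       exists y, [/\ index y L < index x L, M' y & ~~ M y]} ->
  lex_weight L M <= lex_weight L M' /\ (lex_weight L M = lex_weight L M' -> {in L, M =1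
      M'}).
Proof.
elim: L => [|a L IH] H; first by split.
have := lex_weight_lt L M; have := lex_weight_lt L M'; rewrite /=.
have [eqa|] := eqVneq (M a) (M' a).
  move=> _ _; have [|le eq] := IH.
    move=> x xL Mx nMx; have [|y [] /=] := H x _ Mx nMx; first by rewrite inE xL orbT.
    have [eax|ax] := eqVneq a x; first by [].
    have [<-|ay] := eqVneq a y; first by rewrite eqa => _ ->.
    by rewrite ltnS => lt My nMy; exists y.
  rewrite eqa leq_add2l; split=> // /addnI/eq{}eq x.
  by rewrite inE => /predU1P[->|/eq//].
have := H a (mem_head _ _); rewrite /= eqxx.
case: (M a) => [/(_ isT)|_]; case: (M' a) => //=.
  by move=> /(_ isT)[y []].
by rewrite mul1n mul0n => _ lt lt'; split; lia.
Qed.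

(** Where compression removes s from a slice, it has added some larger monomial of
the same slice and degree, by equality of cardinals. So the first change in
lexicographic order is an addition. *)
Lemma compress_weight i a A M (L := lexsort (box (insert_at i a A))) : i <= size A ->
  lex_weight L M <= lex_weight L (compress i A M) /\
  (lex_weight L M = lex_weight L (compress i A M) ->
     {in L, M =1 compress i A M}).
Proof.
move=> le; apply: lex_weight_le => s; rewrite mem_sort mem_box => sA Ms nMs.
have [e [m [es ea mA]]] := in_box_insert_atP le sA; subst s.
have sz := in_box_size mA; rewrite compress_insert_at ?sz // in nMs.
set N := fun m => M (insert_at i e m) in nMs.
pose d := sumn m.
have mL : m \in layer A d by rewrite mem_layer mA eqxx.
have [u uL] : exists2 u, u \in layer A d & lexify A N u && ~~ N u.
  apply/hasP; apply: contraT => /hasPn H.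
  suff : count (lexify A N) (layer A d) < count N (layer A d) by rewrite count_lexify
      ltnn.
  apply: (count_lt_in _ mL) => // x xA Lx; apply: contraT => nNx.
  by have := H x xA; rewrite Lx nNx.
case/andP=> Lu nNu; exists (insert_at i e u).
have uA : in_box A u by move: uL; rewrite mem_layer => /andP[].
rewrite compress_insert_at ?(in_box_size uA) //; split=> //.
apply: index_lexsort; rewrite ?mem_box ?in_box_insert_at ?ea ?(in_box_size uA) //.
rewrite lexlt_insert_at ?(in_box_size uA) //.
have mu : m != u by apply: contraNneq nMs => ->.
case/orP: (lexlt_total mu) => // um.
by case/negP: nMs; apply: (@lex_initial_lexify _ _ d) um Lu.
Qed.

(** A set of maximal weight among the upsets with the given numbers of elements is
left unchanged by every compression. *)
Lemma exists_compressed A M : upset A M ->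
    (forall j, j < size A -> lexifiable (delete_at j A)) ->
  exists M', [/\ upset A M', compressed A M' &
    forall d, count M' (layer A d) = count M (layer A d)].
Proof.
move=> uM LA; pose L := lexsort (box A).
pose good M' := upset A M' /\ forall d, count M' (layer A d) = count M (layer A d).
pose P k := `[< exists2 M', good M' & lex_weight L M' = k >].
have exP : exists k, P k by exists (lex_weight L M); apply/asboolP; exists M.
have leP k : P k -> k <= 2 ^ size L by move=> /asboolP[M' _ <-]; exact/ltnW/lex_weight_lt.
case: (ex_maxnP exP leP) => k /asboolP[M' [uM' cM'] wM'] maxk.
exists M'; split=> // s t sA tA dst st [j jA nst] Ms.
have EA := insert_at_delete_at jA; set a := nth 0 A j in EA;
    set A' := delete_at j A in EA.
have jA' : j <= size A' by rewrite -ltnS size_delete_at.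
have := @compress_weight j a A' M' jA'; rewrite EA -/L => -[le eq].
have /maxk : P (lex_weight L (compress j A' M')).
  apply/asboolP; exists (compress j A' M') => //; split.
    by rewrite -EA; apply: compress_upset; rewrite ?EA //; apply: LA.
  by move=> d; rewrite -cM' -EA count_compress.
(* Maximality of the weight makes M' equal to its compression. *)
rewrite -wM' => ge; have {}eq : {in L, M' =1 compress j A' M'} by apply: eq; lia.
have inL u : in_box A u -> u \in L by rewrite mem_sort mem_box.
move: Ms; rewrite !eq ?inL //.
have [sj tj] : j < size s /\ j < size t by rewrite (in_box_size sA) (in_box_size tA).
have EE u : in_box A u -> in_box A' (delete_at j u).
  move=> uA; move: (uA); rewrite -{1}[u](@insert_at_delete_at j) ?(in_box_size uA) //
      -EA in_box_insert_at.
    by case/andP.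
  by apply: succn_inj; rewrite !size_delete_at ?(in_box_size uA).
have dE u : j < size u -> sumn u = nth 0 u j + sumn (delete_at j u).
  by move=> uj; rewrite -{1}(insert_at_delete_at uj) sumn_insert_at.
have [ds dt] := (dE s sj, dE t tj).
rewrite /compress -nst; apply: (@lex_initial_lexify _ _ (sumn (delete_at j s))).
- by rewrite mem_layer EE ?eqxx.
- by rewrite mem_layer EE //=; lia.
move: st; rewrite -{1}(insert_at_delete_at sj) -{1}(insert_at_delete_at tj) -nst
    lexlt_insert_at //.
by apply: succn_inj; rewrite !size_delete_at // (in_box_size sA) (in_box_size tA).
Qed.

(** * Comparing slices of a compressed set with those of its lexification *)

Lemma in_box_rcons A a m e : size m = size A ->
  in_box (rcons A a) (rcons m e) = (e < a) && in_box A m.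
Proof. by move=> sz; rewrite -!insert_at_last sz in_box_insert_at. Qed.

Lemma exp_le_rcons s e t f : size s = size t ->
  exp_le (rcons s e) (rcons t f) = (e <= f) && exp_le s t.
Proof. by move=> sz; rewrite -!insert_at_last sz exp_le_insert_at. Qed.

(** From x^m y^(e+k), with y the last variable, to a larger x^t y^e: trade the k
factors y for other variables one at a time, staying below x^t. Each trade
changes two exponents only, hence is a step inside a slice when there is a third
variable. *)
Lemma compressed_climb A a M k e m t :
    compressed (rcons A a) M -> 1 < size A ->
    in_box A m -> in_box A t -> e + k < a -> sumn t = sumn m + k -> lexlt m t ->
  M (rcons m (e + k)) -> M (rcons t e).
Proof.
move=> cM A2; elim: k m => [|k IH] m mA tA ea dt mt.
  have [mz tz] := (in_box_size mA, in_box_size tA).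
  rewrite !addn0 in ea dt *; apply: cM.
  - by rewrite in_box_rcons ?ea.
  - by rewrite in_box_rcons ?ea.
  - by rewrite !sumn_rcons dt.
  - by rewrite lexlt_rcons ?mz // mt.
  - exists (size A); first by rewrite size_rcons.
    by rewrite -{1}mz -{1}tz !nth_rcons !ltnn !eqxx.
have [|u [uA mu du ut]] := lex_successor mA tA _ mt; first by lia.
have [mz uz] := (in_box_size mA, in_box_size uA).
have mu' : m != u by apply: contra_eqN du => /eqP <-; rewrite neq_ltn ltnSn.
move=> Mm; have {Mm}: M (rcons u (e + k)).
  apply: cM Mm.
  - by rewrite in_box_rcons ?mA ?ea.
  - by rewrite in_box_rcons ?uA ?andbT //; lia.
  - by rewrite !sumn_rcons du; lia.
  - by rewrite lexlt_rcons ?mz // exp_le_lex.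
  - have [|j js nj] := cover_share mu du; first by rewrite mz.
    exists j; first by rewrite size_rcons -mz ltnS ltnW.
    by rewrite !nth_rcons js uz -mz js.
case: ut => [ut|ut]; last by apply: IH => //; lia.
have -> : k = 0 by move: dt; rewrite -ut du; lia.
by rewrite addn0 ut.
Qed.

Section Comparison.
Variables (A : seq nat) (a : nat) (M : pred (seq nat)).
Hypothesis (cM : compressed (rcons A a) M) (A2 : 1 < size A).
Local Notation L := (lexify (rcons A a) M).

Lemma mem_layer_rcons d e m : e < a -> e <= d -> m \in layer A (d - e) ->
  rcons m e \in layer (rcons A a) d.
Proof.
move=> ea ed; rewrite !mem_layer => /andP[mA /eqP dm].
rewrite in_box_rcons ?(in_box_size mA) // ea mA sumn_rcons dm /=.
by rewrite subnK.
Qed.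

Lemma lex_initial_slice P d e : lex_initial (rcons A a) d P -> e < a -> e <= d ->
  lex_initial A (d - e) (fun m => P (insert_at (size A) e m)).
Proof.
move=> iP ea ed m t mA tA mt.
have [mz tz] : size m = size A /\ size t = size A.
  by move: mA tA; rewrite !mem_layer => /andP[/in_box_size -> _] /andP[/in_box_size -> _].
rewrite -{1}mz -tz !insert_at_last; apply: iP; rewrite ?mem_layer_rcons //.
by rewrite lexlt_rcons ?mz // mt.
Qed.

Lemma compressed_lex_initial_slice d e : e < a -> e <= d ->
  lex_initial A (d - e) (fun m => M (insert_at (size A) e m)).
Proof.
move=> ea ed m t; rewrite !mem_layer => /andP[mA /eqP dm] /andP[tA /eqP dt] mt.
have [mz tz] := (in_box_size mA, in_box_size tA).
rewrite -{1}mz -tz !insert_at_last => Mm.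
apply: (@compressed_climb _ _ _ 0 _ _ _ cM A2 mA tA _ _ mt); rewrite ?addn0 //.
by rewrite dm dt.
Qed.

(** Downward induction on j from the equality j = a. The step is clear if slice j
of L has at least as many elements as that of M. Otherwise some x^m y^j is in M
but not in L; every element x^t y^e of L with e < j lies beyond it, and
[compressed_climb] puts x^t y^e in M, so that L_e is contained in M_e. *)
Lemma slices_compare d j : j <= a ->
  \sum_(0 <= e < j) slice_count (size A) L A d e <=
  \sum_(0 <= e < j) slice_count (size A) M A d e.
Proof.
move=> ja; rewrite -(subKn ja); move: (a - j) (leq_subr j a) => k.
elim: k => [|k IH] ka.
  by rewrite subn0 -!count_slices // insert_at_last count_lexify.
have := IH (ltnW ka); rewrite -[a - k](@prednK); last by lia.
rewrite -subnS; set i := a - k.+1 => {}IH.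
have ia : i < a by rewrite /i; lia.
have [le|lt] := leqP (slice_count (size A) M A d i) (slice_count (size A) L A d i).
  by move: IH; rewrite !big_nat_recr //=; lia.
move: lt; rewrite {1 2}/slice_count; case: ifP => // id lt.
have [m mA /andP[Mm nLm]] : exists2 m, m \in layer A (d - i) & M (rcons m i) && ~~ L
    (rcons m i).
  apply/hasP; apply: contraLR lt => /hasPn H; rewrite -leqNgt.
  apply: count_le_in => m mA; have := H m mA.
  have mz : size m = size A by move: mA; rewrite mem_layer => /andP[/in_box_size].
  by rewrite -mz !insert_at_last negb_and negbK; case: (M _).
rewrite !big_mkord; apply: leq_sum => -[e /= ei] _; rewrite /slice_count.
have ed : e <= d by lia.
rewrite ed; apply: count_le_in => t tA.
have rmA := mem_layer_rcons ia id mA; have rtA := mem_layer_rcons (ltn_trans ei ia) ed tA.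
move: mA tA; rewrite !mem_layer => /andP[mA /eqP dm] /andP[tA /eqP dt].
have [mz tz] := (in_box_size mA, in_box_size tA).
rewrite -{1}tz -{1}tz !insert_at_last => Lt.
have mt : lexlt (rcons m i) (rcons t e).
  have : rcons m i != rcons t e.
    by apply: contraNneq nLm => ->.
  by case/lexlt_total/orP => // tm; case/negP: nLm;
      exact: (lex_initial_lexify rtA rmA tm Lt).
apply: (@compressed_climb A a M (i - e) e m t cM A2 mA tA).
- by rewrite subnKC // ltnW.
- by rewrite dm dt; lia.
- by move: mt; rewrite lexlt_rcons ?mz // => /orP[//|/andP[_ ie]];
    move: (ltn_trans ie ei); rewrite ltnn.
- by rewrite subnKC // ltnW.
Qed.

(** The multiples of L of degree d+1 are compared with M slice by slice in the
exponent of the last variable: slice 0 by the inclusion of L_0 in M_0, slice e+1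
by the inequality between the sums of the slices up to e. *)
Lemma compressed_lexify_upset : upset (rcons A a) M -> upset (rcons A a) L.
Proof.
move=> uM; apply: lexify_upset => d.
rewrite -[X in layer X d.+1](insert_at_last a A) !count_slices //.
case: (posnP a) => [a0|a_gt0]; first by rewrite !big_geq ?a0.
rewrite -[X in index_iota 0 X](prednK a_gt0) !big_nat_recl //; apply: leq_add.
  rewrite /slice_count leq0n subn0; apply: count_le_in => t tA.
  have := tA; rewrite mem_layer => /andP[tb /eqP dt]; have tz := in_box_size tb.
  rewrite -{1}tz insert_at_last => /hasP[s sL /andP[Ls]].
  have := sL; rewrite mem_layer => /andP[sA /eqP ds].
  have sz : 0 < size s by rewrite (in_box_size sA) size_rcons.
  case/lastP: s sz sL Ls sA ds => // s e _ sL Ls sA ds st.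
  have sz : size s = size A by have := in_box_size sA; rewrite !size_rcons => -[].
  move: st; rewrite exp_le_rcons ?tz // leqn0 => /andP[/eqP e0 st]; subst e.
  have sA' : in_box A s by move: sA; rewrite in_box_rcons // => /andP[].
  rewrite sumn_rcons addn0 in ds.
  have Ms : M (insert_at (size A) 0 s).
    have := slices_compare d a_gt0; rewrite !big_nat1 /slice_count leq0n.
    move/(lex_initial_nested (lex_initial_slice (@lex_initial_lexify _ M d) a_gt0
        (leq0n _))
             (compressed_lex_initial_slice a_gt0 (leq0n d))); apply.
      by rewrite mem_layer sA' subn0 ds eqxx.
    by rewrite -sz insert_at_last.
  apply: uM Ms; last by rewrite exp_le_insert_at ?sz ?tz.
  by rewrite -tz insert_at_last in_box_rcons // a_gt0.
have le_pa : a.-1 <= a by lia.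
apply: leq_trans (leq_trans (slices_compare d le_pa) _).
  rewrite !big_mkord; apply: leq_sum => -[e /= ea] _; rewrite /slice_count ltnS subSS.
  case: ifP => // ed; apply: count_le_in => t tA.
  have rt := mem_layer_rcons (leq_trans ea le_pa) ed tA.
  have := tA; rewrite mem_layer => /andP[tb /eqP dt]; have tz := in_box_size tb.
  rewrite -{1 2}tz !insert_at_last => /hasP[s sL /andP[Ls]].
  have := sL; rewrite mem_layer => /andP[sA /eqP ds].
  have sz : 0 < size s by rewrite (in_box_size sA) size_rcons.
  case/lastP: s sz sL Ls sA ds => // s f _ sL Ls sA ds.
  have sz : size s = size A by have := in_box_size sA; rewrite !size_rcons => -[].
  rewrite exp_le_rcons ?tz // => /andP[fe st].
  rewrite sumn_rcons in ds.
  have [est|nst] := eqVneq s t.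
    by move: Ls; rewrite est; have -> // : f = e by rewrite est in ds; lia.
  apply: lex_initial_lexify sL rt _ Ls.
  by rewrite lexlt_rcons ?sz ?tz // exp_le_lex.
rewrite !big_mkord; apply: leq_sum => -[e /= ea] _; rewrite /slice_count ltnS subSS.
case: ifP => // ed; apply: count_le_in => t.
rewrite mem_layer => /andP[tb _]; have tz := in_box_size tb.
rewrite -{1 2}tz !insert_at_last; apply: uM;
  first by rewrite in_box_rcons // tb andbT; lia.
by rewrite exp_le_rcons // exp_le_refl leqnSn.
Qed.

End Comparison.

(** * The theorem of Clements and Lindström *)

Lemma leq_count_inj (T1 T2 : eqType) (f : T1 -> T2) s1 s2 (P : pred T1) (Q : pred T2) :
    uniq s1 -> {in [pred x | (x \in s1) && P x] &, injective f} ->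
    {in s1, forall x, P x -> f x \in s2 /\ Q (f x)} ->
  count P s1 <= count Q s2.
Proof.
move=> us fi H; rewrite -!size_filter -(size_map f); apply: uniq_leq_size.
  rewrite map_inj_in_uniq ?filter_uniq // => x y.
  by rewrite !mem_filter => Px Py; apply: fi; rewrite inE andbC.
by move=> y /mapP[x]; rewrite !mem_filter => /andP[Px /H/(_ Px)[fx Qx]] ->; rewrite Qx.
Qed.

Lemma in_box2 a b s : in_box [:: a; b] s ->
  exists i j, [/\ s = [:: i; j], i < a & j < b].
Proof.
move=> sA; have := in_box_size sA; case: s sA => [|i [|j [|]]] //.
by case/and3P=> ia jb _ _; exists i, j.
Qed.

(** In two variables a monomial of degree d is given by its first exponent. *)
Definition on_antidiagonal b d (Q : pred (seq nat)) i :=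
    [&& i <= d, d - i < b & Q [:: i; d - i]].

Lemma count_layer2 a b d Q :
  count Q (layer [:: a; b] d) = count (on_antidiagonal b d Q) (iota 0 a).
Proof.
have /permP -> : perm_eq (layer [:: a; b] d)
    [seq [:: i; d - i] | i <- [seq i <- iota 0 a | (i <= d) && (d - i < b)]].
  apply: uniq_perm; first exact: layer_uniq.
    rewrite map_inj_uniq ?filter_uniq ?iota_uniq // => x y; case=> //.
  move=> m; rewrite mem_layer; apply/andP/mapP => [[mA /eqP dm]|[i]].
    case/in_box2: mA dm => i [j [-> ia jb]] /= dm; exists i; last by congr [:: _; _]; lia.
    by rewrite mem_filter mem_iota; lia.
  rewrite mem_filter mem_iota => /andP[/andP[id db] /= ia ->]; rewrite !in_box_cons ia db.
  by split=> //=; lia.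
by rewrite count_map count_filter; apply: eq_count => i;
    rewrite /on_antidiagonal /= andbC andbA.
Qed.

(** A multiple x^i y^(d+1-i) of the segment L comes from x^i y^(d-i), which lies
beyond x^(i-1) y^(d+1-i); the only exception is the pure power x^(d+1). *)
Lemma on_antidiagonal_shadow a b M d (L := lexify [:: a; b] M) i :
    a <= b -> i < a ->
    on_antidiagonal b d.+1 (fun t => has (fun s => L s && exp_le s t) (layer [:: a;
        b] d)) i ->
  on_antidiagonal b d L i \/ i = d.+1 /\ on_antidiagonal b d L d.
Proof.
move=> ab ia /and3P[id db /hasP[s sA /andP[Ls st]]].
have := sA; rewrite mem_layer => /andP[sb /eqP ds].
case/in_box2: sb sA ds Ls st => x [y [-> xa yb]] sA /= ds Ls;
    rewrite !exp_le_cons andbT => /andP[xi yi].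
rewrite addn0 in ds.
have [xd|nxd] := eqVneq i d.+1; [right|left].
  split=> //; have [ex ey] : x = d /\ y = 0 by lia.
  by rewrite /on_antidiagonal leqnn subnn; move: Ls; rewrite ex ey => ->; lia.
have id' : i <= d by lia.
rewrite /on_antidiagonal id' /=; apply/andP; split; first by lia.
have [xi'|nxi] := eqVneq x i; first by have <- : y = d - i; [lia|rewrite -xi'].
apply: (lex_initial_lexify sA) Ls; last by rewrite lexlt_cons; lia.
by rewrite mem_layer !in_box_cons ia /= andbT; lia.
Qed.

(** Let c count M in degree d. If M does not fill degree d+1, the multiples of the
segment number at most c, or c+1 when d+1 < a and c > 0. In the first case
x^j y^(d+1-j) outside M gives an injection of M in degree d into M in degree
d+1: multiply by x when the exponent of x is below j and by y when it is above.
In the second case, fix m in M and multiply by y what has a smaller exponent of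
x than m, and by x the rest; this misses the multiple of m by y. *)
Lemma lexifiable2 a b : a <= b -> lexifiable [:: a; b].
Proof.
move=> ab M uM; apply: lexify_upset => d.
set L := lexify _ M; set P := (X in count X _ <= _).
have [/allP full|] := boolP (all M (layer [:: a; b] d.+1)).
  by apply: count_le_in => x /full.
case/allPn => s; rewrite mem_layer => /andP[sb /eqP ds].
case/in_box2: sb ds => j [j' [-> ja j'b]] /= dj nMj.
have {j'b}jb : d.+1 - j < b by lia.
have jd : j <= d.+1 by lia.
have {}nMj : ~~ M [:: j; d.+1 - j] by have <- : j' = d.+1 - j by lia.
have shift i : on_antidiagonal b d M i -> i.+1 < a -> on_antidiagonal b d.+1 M i.+1.
  case/and3P=> id db Mi ia; rewrite /on_antidiagonal subSS ltnS id db; apply: uM Mi.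
    by rewrite !in_box_cons ia db.
  by rewrite !exp_le_cons leqnSn leqnn.
have stay i : on_antidiagonal b d M i -> i < a -> d.+1 - i < b -> on_antidiagonal b
    d.+1 M i.
  case/and3P=> id _ Mi ia db; rewrite /on_antidiagonal db ltnW //=; apply: uM Mi.
    by rewrite !in_box_cons ia db.
  by rewrite !exp_le_cons leqnn andbT; lia.
have nej i : i < a -> on_antidiagonal b d M i -> j != i.
  move=> ia Mi; apply: contraNneq nMj => eji; rewrite eji in jb *.
  by case/and3P: (stay i Mi ia jb).
have cL : count (on_antidiagonal b d L) (iota 0 a) = count (on_antidiagonal b d M)
    (iota 0 a).
  by rewrite -!count_layer2 count_lexify.
have [ad|da] := leqP a d.+1.
  apply: (@leq_trans (count (on_antidiagonal b d M) (iota 0 a))).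
    rewrite -cL count_layer2; apply: count_le_in => i;
        rewrite mem_iota add0n => /andP[_ ia].
    by case/(on_antidiagonal_shadow ab ia) => // -[]; lia.
  rewrite count_layer2; apply: (@leq_count_inj _ _ (fun i => if i < j then i.+1 else i)).
  - exact: iota_uniq.
  - move=> x y; rewrite !inE !mem_iota !add0n => /andP[/andP[_ xa] /(nej _ xa) xj].
    by move=> /andP[/andP[_ ya] /(nej _ ya) yj]; case: (ltnP x j); case: (ltnP y j); lia.
  move=> i; rewrite !mem_iota !add0n => /andP[_ ia] Mi; case: ltnP => ij.
    by split; [lia|apply: shift => //; lia].
  by split=> //; apply: stay => //; have := nej i ia Mi; lia.
have [/eqP c0|] := boolP (count (on_antidiagonal b d L) (iota 0 a) == 0).
  rewrite count_layer2 (_ : count _ (iota 0 a) = 0) //.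
  apply/eqP; rewrite -leqn0 leqNgt -has_count; apply/hasPn => i;
      rewrite mem_iota add0n => /andP[_ ia].
  have H k : k < a -> ~~ on_antidiagonal b d L k.
    move=> ka; apply/negP => Lk;
        suff : 0 < count (on_antidiagonal b d L) (iota 0 a) by rewrite c0.
    by rewrite -has_count; apply/hasP; exists k => //; rewrite mem_iota.
  apply/negP => /(on_antidiagonal_shadow ab ia)[Li|[_ Ld]]; first by move/negP: (H i ia).
  by have /H/negP : d < a by lia.
rewrite cL -lt0n -has_count => /hasP[i0]; rewrite mem_iota add0n => /andP[_ i0a] Mi0.
apply: (@leq_trans (count (on_antidiagonal b d M) (iota 0 a)).+1).
  rewrite -cL count_layer2 -[X in _ <= X]addn1.
  apply: (@leq_trans (count (fun i =>
      on_antidiagonal b d L i || (i == d.+1)) (iota 0 a))).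
    apply: count_le_in => i; rewrite mem_iota add0n => /andP[_ ia].
    move=> Pi; have [Li|[id _]] := on_antidiagonal_shadow ab ia Pi; first by rewrite Li.
    by rewrite id eqxx orbT.
  rewrite -(leq_add2r (count (predI (on_antidiagonal b d L) (pred1 d.+1)) (iota 0 a)))
      count_predUI.
  rewrite -addnA leq_add2l (leq_trans _ (leq_addr _ _)) //.
  by rewrite count_uniq_mem ?iota_uniq // leq_b1.
have Mi0' : on_antidiagonal b d.+1 M i0 by case/and3P: (Mi0) => id _ _;
    apply: stay => //; lia.
rewrite count_layer2.
apply: (@leq_ltn_trans (count (fun i =>
    on_antidiagonal b d.+1 M i && (i != i0)) (iota 0 a))).
  apply: (@leq_count_inj _ _ (fun i => if i < i0 then i else i.+1)).
  - exact: iota_uniq.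
  - by move=> x y _ _ /=; case: (ltnP x i0); case: (ltnP y i0); lia.
  move=> i; rewrite !mem_iota !add0n => /andP[_ ia] Mi; have /and3P[id _ _] := Mi.
  case: ltnP => ij.
    by split; [lia|rewrite stay ?neq_ltn ?ij //; lia].
  by split; [lia|rewrite shift ?neq_ltn ?ltnS ?ij ?orbT //; lia].
apply: (@count_lt_in _ _ _ _ i0); rewrite ?eqxx ?andbF ?mem_iota //.
by move=> x _ /andP[].
Qed.

Lemma delete_at_sorted j A : sorted leq A -> sorted leq (delete_at j A).
Proof.
move=> sA; apply: subseq_sorted sA => //; first exact: leq_trans.
rewrite /delete_at -[in X in subseq _ X](cat_take_drop j A) cat_subseq //.
by rewrite -add1n -drop_drop drop_subseq.
Qed.

(** With at most one variable a degree of the box has at most one element, so every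
set is lexicographic. With three or more, the set is first replaced by one with
the same numbers of elements, hence the same lexification, all of whose slices
are lexicographic. *)
Theorem clements_lindstrom A : sorted leq A -> lexifiable A.
Proof.
move: {2}(size A) (erefl (size A)) => n; elim: n A => [|n IH] A szA sA.
  move=> M uM; apply: initial_lexify_upset => // d s t; rewrite !mem_layer.
  move=> /andP[/in_box_size + _] /andP[/in_box_size + _]; rewrite szA.
  by move=> /eqP/nilP -> /eqP/nilP ->; rewrite lexlt_irr.
case: A szA sA => // a [|b [|c A]] szA sA.
- move=> M uM; apply: initial_lexify_upset => // d s t; rewrite !mem_layer.
  move=> /andP[/in_box_size + /eqP +] /andP[/in_box_size + /eqP +].
  by case: s t => [|x [|x' s]] [|y [|y' t]] //= _ + _; rewrite !addn0 => -> ->;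
      rewrite lexlt_irr.
- by apply: lexifiable2; case/andP: sA.
move=> M uM; have [|M' [uM' cM' eM]] := exists_compressed uM.
  move=> j jA; apply: IH; last exact: delete_at_sorted.
  by apply: succn_inj; rewrite size_delete_at.
have EL : lexify [:: a, b, c & A] M' =1 lexify [:: a, b, c & A] M.
  by move=> m; rewrite /lexify eM.
have {}uM' : upset [:: a, b, c & A] (lexify [:: a, b, c & A] M').
  rewrite lastI in uM' cM' *; apply: compressed_lexify_upset => //.
by move=> s t tA st; rewrite -!EL; exact: uM'.
Qed.

(** * Lex ideals of a box as stacks of slices *)

Definition origin (A : seq nat) : seq nat := nseq (size A) 0.

Lemma in_box_origin A : all (leq 1) A -> in_box A (origin A).
Proof. by elim: A => // a A IH /andP[a_gt0 /IH];
    rewrite /origin /= in_box_cons a_gt0. Qed.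

Lemma exp_le_origin m : exp_le (nseq (size m) 0) m.
Proof. by elim: m. Qed.

Lemma sumn_origin A : sumn (origin A) = 0.
Proof. by rewrite /origin sumn_nseq. Qed.

Lemma sumn0_origin A m : in_box A m -> sumn m = 0 -> m = origin A.
Proof.
move=> mA m0; apply/esym/exp_le_sumn_eq; last by rewrite m0.
by rewrite /origin -(in_box_size mA) exp_le_origin.
Qed.

Lemma exp_le_of_degree t k : k <= sumn t -> exists2 s, exp_le s t & sumn s = k.
Proof.
move=> kt; rewrite -(subKn kt); move: (sumn t - k) => j.
elim: j => [|j [s st ds]]; first by exists t; rewrite ?exp_le_refl ?subn0.
have [s_gt0|] := posnP (sumn s); first by exists s => //; lia.
by case/cover_below=> u [us du]; exists u; [exact: exp_le_trans us st|lia].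
Qed.

(** Compared with a lex plus powers ideal, the pure powers with exponents below
those of the box are also subject to the lexicographic condition. *)
Definition lexideal (A : seq nat) (M : pred (seq nat)) : Prop :=
  [/\ upset A M, forall d, lex_initial A d M & ~~ M (origin A)].

Lemma lexideal_gt0 A M m : lexideal A M -> in_box A m -> M m -> 0 < sumn m.
Proof.
by move=> [_ _ nM] mA Mm; case: posnP => // /(sumn0_origin mA) m0; rewrite -m0 Mm in nM.
Qed.

Lemma lexideal_initial A M s t : lexideal A M -> in_box A s -> in_box A t ->
  sumn s = sumn t -> lexlt s t -> M s -> M t.
Proof.
by move=> [_ iM _] sA tA dst; apply: (iM (sumn s)); rewrite mem_layer ?sA ?tA ?dst eqxx.
Qed.

(** The invariant alpha: the monomials of M in the box are those outside the ideal
of the powers x_i^(a_i). *)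
Definition min_degree (B : seq nat) (M : pred (seq nat)) (o : option nat) : Prop :=
  if o is Some a then
    (exists m, [/\ in_box B m, M m & sumn m = a]) /\
    (forall m, in_box B m -> M m -> a <= sumn m)
  else forall m, in_box B m -> ~~ M m.

(** The invariant sigma: an upset is full in all degrees from its first full one on. *)
Definition full_degree (B : seq nat) (M : pred (seq nat)) (s : nat) : Prop :=
  (forall m, in_box B m -> s <= sumn m -> M m) /\
  (exists m, [/\ in_box B m, ~~ M m & (sumn m).+1 = s]).

Definition box_top (A : seq nat) : seq nat := map predn A.

Lemma exp_le_box_top A m : in_box A m -> exp_le m (box_top A).
Proof.
elim: A m => [|a A IH] [|x m] //; rewrite in_box_cons => /andP[xa /IH].
by rewrite /= exp_le_cons => ->; lia.
Qed.

Lemma in_box_box_top A : all (leq 1) A -> in_box A (box_top A).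
Proof. by elim: A => // a A IH /= /andP[a0 /IH]; rewrite in_box_cons => ->; lia. Qed.

Lemma full_degree_empty A M s : all (leq 1) A -> full_degree A M s ->
  (forall m, in_box A m -> ~~ M m) -> s = (sumn (box_top A)).+1.
Proof.
move=> A_pos [fM [m [mA _ dm]]] eM; apply/eqP; rewrite eqn_leq -{1}dm ltnS.
rewrite exp_le_sumn ?exp_le_box_top //= ltnNge; apply/negP => le.
by have := eM _ (in_box_box_top A_pos); rewrite fM // in_box_box_top.
Qed.

Section Slices.
Variables (a u : nat) (A : seq nat) (F : nat -> pred (seq nat)).
Hypothesis F_lex : forall e, e < u -> lexideal A (F e).
Hypothesis F_full : forall e m, u <= e -> F e m.
Hypothesis F_next : forall e m t, e.+1 < u -> in_box A m -> in_box A t ->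
  F e m -> sumn m <= (sumn t).+1 -> F e.+1 t.

(** Iteration of F_next along a chain of divisors of m, one degree less at each
slice. *)
Lemma slices_climb e f m t : e < f -> in_box A m -> in_box A t ->
  F e m -> e + sumn m <= f + sumn t -> F f t.
Proof.
move=> ef; rewrite -(subnKC ef); move: (f - e.+1) => k {ef}.
elim: k e m => [|k IH] e m mA tA Fm le.
  rewrite addn0; have [eu|/F_full] := ltnP e.+1 u; last by apply.
  by apply: F_next Fm _ => //; lia.
have [eu|ue] := ltnP e u; last by apply: F_full; lia.
have := lexideal_gt0 (F_lex eu) mA Fm => /cover_below[v [vm dv]].
have vA := exp_le_in_box vm mA.
rewrite addnS -addSn; apply: (IH e.+1 v vA tA); last by lia.
have [eu'|/F_full] := ltnP e.+1 u; last by apply.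
by apply: F_next Fm _ => //; lia.
Qed.

Hypotheses (u_gt0 : 0 < u) (A_pos : all (leq 1) A).

Definition assemble : pred (seq nat) := fun m => F (head 0 m) (behead m).

Lemma in_box_consP m : in_box (a :: A) m ->
  exists e s, [/\ m = e :: s, e < a & in_box A s].
Proof. by case: m => // e s /andP[]; exists e, s. Qed.

Lemma assemble_lexideal : lexideal (a :: A) assemble.
Proof.
split.
- move=> s t tA st; have sA := exp_le_in_box st tA.
  have [e [m [es _ mA]]] := in_box_consP sA; have [f [v [et _ vA]]] := in_box_consP tA.
  subst s t; move: st; rewrite exp_le_cons /assemble /= => /andP[ef mv].
  have [<-|nef] := eqVneq e f.
    have [eu|/F_full] := ltnP e u; last by move=> H _.
    by have [upF _ _] := F_lex eu; exact: upF.
  move=> Fm; apply: slices_climb Fm _ => //; first by rewrite ltn_neqAle nef.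
  by rewrite leq_add ?exp_le_sumn.
- move=> d s t; rewrite !mem_layer => /andP[sA /eqP ds] /andP[tA /eqP dt].
  have [e [m [es _ mA]]] := in_box_consP sA; have [f [v [et _ vA]]] := in_box_consP tA.
  subst s t; rewrite /assemble lexlt_cons /= in ds dt *.
  case/orP=> [ef Fm|/andP[/eqP ef mv]]; first by apply: slices_climb Fm _ => //;
      rewrite ds dt.
  subst f.
  have [eu|/F_full] := ltnP e u; last by move=> H _.
  by apply: (lexideal_initial (F_lex eu)) => //; lia.
- by have [_ _] := F_lex u_gt0.
Qed.

(** If u < a, no element lies below x_1^u: an element of degree d < u would put 1 in
slice d. If u = a, climbing to the last slice that avoids 1 loses nothing. *)
Lemma assemble_min_degree o : u <= a -> min_degree A (F u.-1) o ->
  min_degree (a :: A) assemble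
    (if u < a then Some u else omap (fun b => u + b - 1) o).
Proof.
move=> ua Fo; have Flast := F_lex (ltac:(lia) : u.-1 < u).
have climb e m t : e < u.-1 -> in_box A m -> in_box A t -> F e m ->
    e + sumn m <= u.-1 + sumn t -> F u.-1 t by exact: slices_climb.
case: ltnP => [lt_ua|au].
  split.
    exists (u :: origin A); rewrite /assemble /= sumn_origin addn0 F_full //.
    by rewrite in_box_cons lt_ua in_box_origin.
  move=> m /in_box_consP[e [s [-> ea sA]]]; rewrite /assemble /= => Fs.
  rewrite leqNgt; apply/negP => lt; have eu : e < u by lia.
  have s_gt0 := lexideal_gt0 (F_lex eu) sA Fs.
  have [_ _ /negP] := F_lex lt; apply.
  by apply: slices_climb Fs _; rewrite ?in_box_origin //; lia.
case: o Fo => [b [[m [mA Fm dm]] minb]|noF] /=.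
  split.
    exists (u.-1 :: m); rewrite in_box_cons /assemble /= mA Fm dm; split=> //; lia.
  move=> t /in_box_consP[e [s [-> ea sA]]]; rewrite /assemble /= => Fs.
  have [eu|ne] := eqVneq e u.-1; first by rewrite eu in Fs *; have := minb s sA Fs; lia.
  rewrite leqNgt; apply/negP => lt.
  have b_gt0 : 0 < b by rewrite -dm; exact: lexideal_gt0 Flast mA Fm.
  have [v vm dv] := @exp_le_of_degree m b.-1 (ltac:(lia)).
  have vA := exp_le_in_box vm mA.
  have Fv : F u.-1 v by apply: (climb e s) => //; lia.
  by have := minb v vA Fv; lia.
move=> t /in_box_consP[e [s [-> ea sA]]]; rewrite /assemble /=; apply/negP => Fs.
have [eu|ne] := eqVneq e u.-1; first by rewrite eu in Fs; move/negP: (noF s sA).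
by move/negP: (noF s sA); apply; apply: (climb e s s) => //; lia.
Qed.

(** Slice 0 is the slowest to fill up: an element of slice 0 of degree at most s
puts in slice e all monomials of degree s - e or more. *)
Lemma assemble_full_degree s : u <= a -> full_degree A (F 0) s ->
    (exists2 m, in_box A m & F 0 m) ->
  full_degree (a :: A) assemble s.
Proof.
move=> ua [full0 [t [tA nFt dt]]] [m mA Fm].
have [v [vA Fv dv]] : exists v, [/\ in_box A v, F 0 v & sumn v <= s].
  have [le|lt] := leqP (sumn m) s; first by exists m.
  have [v vm dv] := exp_le_of_degree (ltnW lt); exists v.
  by rewrite (exp_le_in_box vm mA) full0 ?dv // (exp_le_in_box vm mA).
split=> [w /in_box_consP[e [x [-> ea xA]]] /= le|].
  rewrite /assemble /=; have [e0|e_gt0] := posnP e; first by rewrite e0 in le *;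
      exact: full0.
  by apply: slices_climb Fv _ => //; lia.
by exists (0 :: t); rewrite in_box_cons /assemble /= tA; split=> //; lia.
Qed.

(** When the first c slices are empty, the largest missing degree is that of the
socle monomial of the smaller box times x_1^(c-1). The next slice, not being
empty, contains this socle monomial, and climbing fills the later ones. *)
Lemma assemble_full_degree_empty s c : u <= a -> full_degree A (F 0) s ->
    0 < c <= u -> (forall e m, e < c -> in_box A m -> ~~ F e m) ->
    (c < u -> exists2 m, in_box A m & F c m) ->
  full_degree (a :: A) assemble (s + c - 1).
Proof.
move=> ua full0 cu emptyF nonempty.
have -> : s = (sumn (box_top A)).+1.
  by apply: (full_degree_empty A_pos full0) => m; apply: emptyF; lia.
have Atop := in_box_box_top A_pos; split.
  move=> w /in_box_consP[e [x [-> ea xA]]] /= le; rewrite /assemble /=.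
  have dx := exp_le_sumn (exp_le_box_top xA).
  have [ue|eu] := leqP u e; first exact: F_full.
  have [|m mA Fm] := nonempty; first by lia.
  have cu' : c < u by lia.
  have {}Fm : F c (box_top A) by have [upF _ _] := F_lex cu'; apply: upF Fm => //;
      exact: exp_le_box_top.
  have [ec|ec] := eqVneq e c; last by apply: slices_climb Fm _ => //; lia.
  rewrite ec in le *; suff -> : x = box_top A by [].
  by apply: exp_le_sumn_eq; [exact: exp_le_box_top|lia].
exists (c.-1 :: box_top A); rewrite in_box_cons /assemble /= Atop emptyF //; last by lia.
by split=> //; lia.
Qed.

End Slices.

(** * The lex ideal of a nested vector *)

(** The slices are read in reverse: the last entry of T is the slice of exponent 0,
and the default value makes all slices from the length of T on full. *)
Fixpoint vec_ideal (n : nat) : nvec n -> pred (seq nat) :=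
  match n return nvec n -> pred (seq nat) with
  | 0 => fun d m => d <= head 0 m
  | n'.+1 => fun T m => nth xpredT [seq vec_ideal T' | T' <- rev T] (head 0 m) (behead m)
  end.

Definition vec_slice n (T : nvec n.+1) (e : nat) : pred (seq nat) :=
  nth xpredT [seq vec_ideal T' | T' <- rev T] e.

Lemma vec_ideal_assemble n (T : nvec n.+1) : vec_ideal T = assemble (vec_slice T).
Proof. by []. Qed.

Lemma vec_slice_lt n (T : nvec n.+1) x0 e : e < size T ->
    vec_slice T e = vec_ideal (nth x0 (rev T) e).
Proof. by move=> eT; rewrite /vec_slice (nth_map x0) ?size_rev. Qed.

Lemma vec_slice_ge n (T : nvec n.+1) e m : size T <= e -> vec_slice T e m.
Proof. by move=> eT; rewrite /vec_slice nth_default // size_map size_rev. Qed.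

Lemma vec_lastE n A (T : nvec n.+1) : vec_last A T = nth (vec_ci n (behead A)) (rev T) 0.
Proof.
by rewrite /vec_last; case/lastP: (T : seq (nvec n)) => // s x;
    rewrite last_rcons rev_rcons.
Qed.

Lemma vec_firstE n A (T : nvec n.+1) : 0 < size T ->
  vec_first A T = nth (vec_ci n (behead A)) (rev T) (size T).-1.
Proof.
by move=> T0; rewrite /vec_first nth_rev ?prednK // subnn nth0.
Qed.

(** If the occurrences of x come first in r, counting them locates their end. *)
Lemma count_prefix (T : eqType) (x0 x : T) r :
    (forall i j, i < j -> j < size r -> nth x0 r j = x -> nth x0 r i = x) ->
  forall e, e < size r -> (nth x0 r e == x) = (e < count_mem x r).
Proof.
elim: r => // y r IH H e /=.
have noX : y <> x -> count_mem x r = 0.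
  move=> nyx; apply/eqP; rewrite -leqn0 leqNgt -has_count; apply/hasP => -[z zr /eqP zx].
  apply: nyx; apply: (H 0 (index x r).+1) => //=; rewrite ?ltnS -zx ?index_mem //.
  by rewrite nth_index.
case: e => [|e] /= er; first by case: eqP => // /noX ->.
rewrite IH //; last by move=> i j ij jr; apply: (H i.+1 j.+1).
by case: eqP => // /noX ->.
Qed.

Lemma vec_ideal_ci n A m : size A = n.+1 -> in_box A m -> ~~ vec_ideal (vec_ci n A) m.
Proof.
elim: n A m => [|n IH] [|a A] m //= [szA] /in_box_consP[e [s [-> ea sA]]] /=.
  by rewrite -ltnNge.
by rewrite (nth_map (vec_ci n A)) ?size_rev ?size_nseq // nth_rev ?size_nseq //
    nth_nseq ltn_subrL (leq_ltn_trans _ ea) //= IH.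
Qed.

(** The induction needs the last part to recognize the empty slices: they are the
entries counted in the definition of sigma. *)
Lemma vec_ideal_spec n A (T : nvec n) : size A = n.+1 -> all (leq 1) A ->
    is_lpp_vec A T ->
  [/\ lexideal A (vec_ideal T), min_degree A (vec_ideal T) (vec_alpha A T),
      full_degree A (vec_ideal T) (vec_sigma A T) &
      (forall m, in_box A m -> ~~ vec_ideal T m) -> T = vec_ci n A].
Proof.
elim: n A T => [|n IH] [|a A] T //= [szA] /andP[a_gt0 A_pos].
  case: A szA A_pos => // _ _ /andP[T_gt0 Ta].
  have single m : in_box [:: a] m -> exists2 x, m = [:: x] & x < a.
    by move=> mA; have := in_box_size mA; case: m mA => [|x []] // /andP[xa _]; exists x.
  split.
  - split; last by rewrite -ltnNge.
      by move=> s t /single[y -> _] st; have := exp_le_size st;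
          case: s st => [|x []] //; rewrite exp_le_cons andbT /= => xy _ /leq_trans;
          apply.
    move=> d s t; rewrite !mem_layer => /andP[/single[x -> _] +] /andP[/single[y -> _]].
    by rewrite /= !addn0 => /eqP -> /eqP ->; rewrite lexlt_irr.
  - case: ltnP => [lt|ge]; last first.
      by move=> m /single[x -> xa] /=; rewrite -ltnNge (leq_trans xa).
    split; first by exists [:: T : nat]; rewrite in_box_cons lt /= addn0.
    by move=> m /single[x -> xa] /=; rewrite addn0.
  - split; first by move=> m /single[x -> xa] /=; rewrite addn0.
    exists [:: (T : nat).-1]; rewrite in_box_cons /= -ltnNge addn0 ltn_predL T_gt0
        prednK //.
    by rewrite (leq_trans _ Ta) // ltn_predL.
  - move=> emp; apply/eqP; rewrite eqn_leq Ta /= leqNgt; apply/negP => lt.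
    by have := emp [:: T : nat]; rewrite in_box_cons lt /= leqnn => /(_ isT).
case/and4P=> /andP[u_gt0 ua] _ /allP allT sortT.
set ci := vec_ci n A; set u := size T in u_gt0 ua *.
have lpp e : e < u -> is_lpp_vec A (nth ci (rev T) e).
  by move=> eu; apply: allT; rewrite -mem_rev mem_nth // size_rev.
have spec e (eu : e < u) := IH A (nth ci (rev T) e) szA A_pos (lpp e eu).
have F_lex e : e < u -> lexideal A (vec_slice T e).
  by move=> eu; have [] := spec e eu; rewrite -vec_slice_lt.
have F_full e m : u <= e -> vec_slice T e m by exact: vec_slice_ge.
have next e : e.+1 < u ->
    lt_option (vec_sigma A (nth ci (rev T) e.+1)) (vec_alpha A (nth ci (rev T) e)).
  move: sortT; rewrite -[T in sorted _ T]revK rev_sorted => /(sortedP ci) H eu.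
  by apply: H; rewrite size_rev.
(* The inequality between sigma and alpha, in terms of slices. *)
have F_next e m t : e.+1 < u -> in_box A m -> in_box A t ->
    vec_slice T e m -> sumn m <= (sumn t).+1 -> vec_slice T e.+1 t.
  move=> eu mA tA Fm le; have eu' : e < u by lia.
  have [_ minE _ _] := spec e eu'; have [_ _ [fullE _] _] := spec e.+1 eu.
  have := next e eu; rewrite !(@vec_slice_lt _ _ ci) // in Fm *.
  case: (vec_alpha _ _) minE => [b [_ minE]|noE] /=; last by move/negP: (noE m mA).
  by move=> sb; apply: fullE => //; have := minE m mA Fm; lia.
have lexT : lexideal (a :: A) (assemble (vec_slice T)) by
  exact: (assemble_lexideal _ F_lex F_full F_next u_gt0).
have emptyE e : e < u -> (forall m, in_box A m -> ~~ vec_slice T e m) ->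
    nth ci (rev T) e = ci.
  by move=> eu; have [_ _ _] := spec e eu; rewrite -vec_slice_lt.
have nonemptyE e : e < u -> nth ci (rev T) e != ci ->
    exists2 m, in_box A m & vec_slice T e m.
  move=> eu nci; have /hasP[m] : has (vec_slice T e) (box A).
    apply: contraNT nci => /hasPn H; rewrite (emptyE e eu) // => m mA.
    by apply: H; rewrite mem_box.
  by rewrite mem_box; exists m.
split; rewrite ?vec_ideal_assemble //.
- have := @assemble_min_degree a u A (vec_slice T) F_lex F_full F_next u_gt0 A_pos
    (vec_alpha A (vec_first (a :: A) T)) ua.
  apply; rewrite vec_firstE // (@vec_slice_lt _ _ ci) ?ltn_predL //.
  by have [] := spec u.-1 (ltac:(lia)).
- rewrite vec_lastE /= -/ci.
  have [_ _ full0 _] := spec 0 u_gt0; rewrite -vec_slice_lt // in full0.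
  case: ifPn => [/eqP T0|nT0]; last first.
    by apply: (@assemble_full_degree a u A (vec_slice T)) => //; exact: nonemptyE.
  (* Climbing from an element of an earlier slice would fill a later one, so the
     empty slices come first. *)
  have cE e : e < u -> (nth ci (rev T) e == ci) = (e < count_mem ci (rev T)).
    move=> eu; apply: count_prefix; last by rewrite size_rev.
    move=> i j ij; rewrite size_rev => ju jci; apply: emptyE => [|m mA];
        first exact: ltn_trans ju.
    apply/negP => Fm; have : vec_slice T j m by apply: (slices_climb F_lex F_full
        F_next ij mA mA Fm); rewrite leq_add2r ltnW.
    by rewrite (@vec_slice_lt _ _ ci) // jci; apply/negP/vec_ideal_ci.
  rewrite {2}T0 -count_rev; apply: (@assemble_full_degree_empty a u A (vec_slice T)) =>
      //.
  + by rewrite -cE // T0 eqxx /u -(size_rev T) count_size.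
  + move=> e m ec mA; have eu : e < u.
      by rewrite (leq_trans ec) // /u -(size_rev T) count_size.
    by move: ec; rewrite -cE // (@vec_slice_lt _ _ ci) // => /eqP ->; exact: vec_ideal_ci.
  + by move=> cu; apply: nonemptyE => //; rewrite cE // ltnn.
- move=> empT; have Eu : u = a.
    apply/eqP; rewrite eqn_leq ua leqNgt; apply/negP => lt.
    have := empT (u :: origin A); rewrite in_box_cons lt in_box_origin // => /(_ isT).
    by move=> /negP; apply; exact: F_full.
  rewrite -Eu; apply/all_pred1P/allP => x; rewrite -mem_rev => xT.
  have eu : index x (rev T) < u by rewrite /u -(size_rev T) index_mem.
  have := emptyE _ eu; rewrite nth_index // => -> /=; first exact: eqxx.
  move=> m mA; have := empT (index x (rev T) :: m); rewrite in_box_cons mA andbT.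
  by apply; rewrite (leq_trans eu).
Qed.

Lemma vec_len_vec_ideal n (T : nvec n) m : vec_ideal T (vec_len T :: m).
Proof. by case: n T => [|n] T //=; rewrite nth_default // size_map size_rev. Qed.

Lemma vec_ideal_inj n A (T T' : nvec n) : size A = n.+1 -> all (leq 1) A ->
    is_lpp_vec A T -> is_lpp_vec A T' ->
  (forall m, in_box A m -> vec_ideal T m = vec_ideal T' m) -> T = T'.
Proof.
elim: n A T T' => [|n IH] [|a A] T T' //= [szA] /andP[a_gt0 A_pos].
  case: A szA A_pos => // _ _ /andP[_ Ta] /andP[_ T'a] H.
  apply/eqP; rewrite eqn_leq; apply/andP; split; rewrite leqNgt; apply/negP => lt.
    by have := H [:: T' : nat];
        rewrite in_box_cons /= leqnn (leq_trans lt) // leqNgt lt => /(_ isT).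
  by have := H [:: T : nat]; rewrite in_box_cons /= leqnn (leq_trans lt) // leqNgt lt
      => /(_ isT).
set ci := vec_ci n A.
move=> /and4P[/andP[u_gt0 ua] _ /allP allT _] /and4P[/andP[u'_gt0 u'a] _ /allP allT' _] H.
have step (S S' : nvec n.+1) : size S <= a -> (forall x, x \in (S : seq (nvec n)) ->
    is_lpp_vec A x) ->
    (forall m, in_box (a :: A) m -> vec_ideal S m = vec_ideal S' m) -> size S <= size S'.
  move=> Sa allS HS; rewrite leqNgt; apply/negP => lt.
  have := HS (size S' :: origin A); rewrite in_box_cons in_box_origin // andbT.
  rewrite !vec_ideal_assemble /assemble /= (@vec_slice_ge _ S') // (@vec_slice_lt _ S
      ci) //.
  have [|[_ _ /negPf->] _ _ _] := @vec_ideal_spec n A (nth ci (rev S) (size S')) szA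
      A_pos.
    by apply: allS; rewrite -mem_rev mem_nth // size_rev.
  by rewrite (leq_trans lt) // => /(_ isT).
have uu : size T = size T'.
  by apply/eqP; rewrite eqn_leq !step // => m mA; exact/esym/H.
apply: (can_inj revK); apply: (@eq_from_nth _ ci); rewrite !size_rev // => e eu.
apply: (IH A) => //.
- by apply: allT; rewrite -mem_rev mem_nth // size_rev.
- by apply: allT'; rewrite -mem_rev mem_nth // size_rev -uu.
move=> m mA; have eA : in_box (a :: A) (e :: m) by rewrite in_box_cons mA (leq_trans eu).
have : vec_slice T e m = vec_slice T' e m by exact: H eA.
by rewrite !(@vec_slice_lt _ _ ci) // -uu.
Qed.

(** * Vectors, lex ideals and Hilbert functions *)

Section SlicesOfIdeal.
Variables (a : nat) (A : seq nat) (M : pred (seq nat)).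
Hypothesis lexM : lexideal (a :: A) M.

Lemma lexideal_slice e : e < a -> ~~ M (e :: origin A) ->
  lexideal A (fun m => M (e :: m)).
Proof.
case: lexM => upM iM _ ea nM; split=> //.
  move=> s t tA st; apply: upM; rewrite ?in_box_cons ?ea //.
  by rewrite exp_le_cons leqnn.
move=> d s t; rewrite !mem_layer => /andP[sA /eqP ds] /andP[tA /eqP dt] st.
apply: (iM (e + d)); rewrite ?mem_layer ?in_box_cons ?ea ?sA ?tA /= ?ds ?dt ?eqxx //.
by rewrite lexlt_cons eqxx st orbT.
Qed.

(** The lexicographic condition, read on consecutive slices of a lex ideal. A
divisor of t of degree one less than m is beyond m once multiplied by x_1. *)
Lemma lexideal_next e m t : e.+1 < a -> in_box A m -> in_box A t ->
  ~~ M (e :: origin A) -> M (e :: m) -> sumn m <= (sumn t).+1 -> M (e.+1 :: t).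
Proof.
case: (lexM) => upM iM _ ea mA tA nM Mm le.
have m_gt0 : 0 < sumn m.
  by case: posnP => // /(sumn0_origin mA) m0; rewrite -m0 Mm in nM.
have [v vt dv] := @exp_le_of_degree t (sumn m).-1 (ltac:(lia)).
have vA := exp_le_in_box vt tA.
have : M (e.+1 :: v).
  apply: (lexideal_initial lexM) Mm; rewrite ?in_box_cons ?mA ?vA ?ea ?andbT //=; try lia.
  by rewrite lexlt_cons ltnSn.
by apply: upM; rewrite ?in_box_cons ?ea // exp_le_cons leqnn.
Qed.

End SlicesOfIdeal.

Lemma vec_len_gt0 n A (T : nvec n) : is_lpp_vec A T -> 0 < vec_len T.
Proof. by case: n T => [|n] T /=; [case/andP|case/and4P=> /andP[]]. Qed.

(** The number u of entries is the least exponent with x_1^u in M, and the entries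
come from the slices by induction. The condition on the length of the last entry
holds because x_2^l in M, with l < u <= a_1 <= a_2, would force x_1^l in M. *)
Lemma vec_ideal_surj n A M : size A = n.+1 -> all (leq 1) A -> sorted leq A ->
    lexideal A M ->
  exists2 T : nvec n, is_lpp_vec A T & forall m, in_box A m -> vec_ideal T m = M m.
Proof.
elim: n A M => [|n IH] [|a A] M //= [szA] /andP[a_gt0 A_pos] sA lexM;
    have [upM iM nM] := lexM.
  case: A szA A_pos sA upM iM nM {lexM} => // _ _ _ upM _ nM.
  pose d := find (fun e => M [:: e]) (iota 0 a).
  have da : d <= a by rewrite -[leqRHS](size_iota 0 a) find_size.
  exists d => [|m mA].
    rewrite da andbT lt0n; apply/negP => /eqP d0; case/negP: nM.
    have := @nth_find _ 0 (fun e => M [:: e]) (iota 0 a); rewrite -/d d0 nth_iota //;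
        apply.
    by rewrite has_find -/d d0 size_iota.
  have [e [s [em ea]]] := in_box_consP mA; subst m; case: s mA => // mA _ /=.
  apply/idP/idP => [de|Me].
    have : M [:: d].
      have := @nth_find _ 0 (fun e => M [:: e]) (iota 0 a);
          rewrite -/d nth_iota ?(leq_ltn_trans de) //; apply.
      by rewrite has_find -/d size_iota (leq_ltn_trans de).
    by apply: upM => //; rewrite exp_le_cons de.
  rewrite leqNgt; apply/negP => ed; have := before_find 0 ed.
  by rewrite nth_iota // Me.
pose u := find (fun e => M (e :: origin A)) (iota 0 a).
have ua : u <= a by rewrite -[leqRHS](size_iota 0 a) find_size.
have lt_u e : e < u -> ~~ M (e :: origin A).
  by move=> eu; have := before_find 0 eu; rewrite nth_iota ?(leq_trans eu) // => ->.
have ge_u e m : in_box (a :: A) (e :: m) -> u <= e -> M (e :: m).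
  move=> mA ue; have /andP[ea mA'] := mA.
  have : M (u :: origin A).
    have := @nth_find _ 0 (fun e => M (e :: origin A)) (iota 0 a).
    rewrite -/u nth_iota ?(leq_ltn_trans ue) //; apply.
    by rewrite has_find -/u size_iota (leq_ltn_trans ue).
  by apply: upM => //; rewrite exp_le_cons ue /origin -(in_box_size mA') exp_le_origin.
have u_gt0 : 0 < u.
  rewrite lt0n; apply/negP => /eqP u0; case/negP: nM.
  by apply: ge_u; rewrite ?u0 // in_box_cons a_gt0 in_box_origin.
have lexS e : e < u -> lexideal A (fun m => M (e :: m)).
  by move=> eu; apply: (lexideal_slice lexM); [exact: leq_trans ua|exact: lt_u].
have /choice[f fP] : forall e, exists T : nvec n, e < u ->
    is_lpp_vec A T /\ forall m, in_box A m -> vec_ideal T m = M (e :: m).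
  move=> e; have [eu|_] := boolP (e < u); last by exists (vec_ci n A).
  by have [T lppT eqT] := IH A _ szA A_pos (path_sorted sA) (lexS e eu); exists T.
pose T : nvec n.+1 := rev [seq f e | e <- iota 0 u].
have sizeT : size T = u by rewrite size_rev size_map size_iota.
have nthT x0 e : e < u -> nth x0 (rev T) e = f e.
  by move=> eu; rewrite revK (nth_map 0) ?size_iota // nth_iota.
have spec e (eu : e < u) := vec_ideal_spec szA A_pos (fP e eu).1.
exists T; last first.
  move=> m /in_box_consP[e [s [-> ea sA']]]; rewrite -[LHS]/(vec_slice T e s).
  have [eu|ue] := ltnP e u.
    by rewrite (@vec_slice_lt _ _ (vec_ci n A)) ?sizeT // nthT //; apply: (fP e eu).2.
  by rewrite vec_slice_ge ?sizeT // ge_u // in_box_cons ea.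
rewrite sizeT u_gt0 ua /=; apply/and3P; split.
- rewrite vec_lastE nthT //= leqNgt; apply/negP => lt.
  have l_gt0 := vec_len_gt0 (fP 0 u_gt0).1; set l := vec_len (f 0) in lt l_gt0.
  case/negP: (lt_u l lt).
  have la : l < a by exact: leq_trans lt ua.
  case EA: A szA A_pos sA => [//|a2 A'] szA A_pos sA.
  have la2 : l < a2 by apply: leq_trans la _; case/andP: sA.
  have A'_pos : all (leq 1) A' by case/andP: A_pos.
  have lA : in_box A (l :: origin A') by rewrite EA in_box_cons la2 in_box_origin.
  have : M (0 :: l :: origin A').
    by rewrite -(fP 0 u_gt0).2 //; exact: vec_len_vec_ideal.
  apply: (lexideal_initial lexM);
      rewrite ?in_box_cons ?a_gt0 ?la ?lA ?EA ?in_box_origin //.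
  by rewrite lexlt_cons l_gt0.
- rewrite all_rev; apply/allP => x /mapP[e]; rewrite mem_iota => /andP[_ eu] ->.
  exact: (fP e eu).1.
rewrite rev_sorted; apply/(sortedP (vec_ci n A)) => e; rewrite size_map size_iota => eu.
have eu' : e < u by exact: ltnW.
rewrite !(nth_map 0) ?size_iota // !nth_iota //.
have [_ minE _ _] := spec e eu'; have [_ _ [_ [t [tA nt dt]]] _] := spec e.+1 eu.
case: (vec_alpha _ _) minE => //= b [[m [mA Mm dm]] _].
rewrite ltnNge; apply/negP => le; case/negP: nt.
rewrite (fP e.+1 eu).2 //; rewrite (fP e eu').2 // in Mm.
apply: (lexideal_next lexM _ mA tA (lt_u _ eu') Mm); first by exact: leq_trans ua.
by rewrite dm dt.
Qed.

(** The Hilbert function of the quotient by M and the monomials outside the box. *)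
Definition box_hilbert (A : seq nat) (M : pred (seq nat)) (d : nat) : nat :=
  count (predC M) (layer A d).

Lemma box_hilbert_alpha A M d :
  box_hilbert A M d < size (layer A d) <-> exists m, [/\ in_box A m, M m & sumn m = d].
Proof.
rewrite /box_hilbert -(count_predC M) -[ltnLHS]add0n ltn_add2r -has_count; split.
  by case/hasP => m; rewrite mem_layer => /andP[mA /eqP dm] Mm; exists m.
by case=> m [mA Mm dm]; apply/hasP; exists m; rewrite // mem_layer mA dm eqxx.
Qed.

Lemma box_hilbert_eq0 A M d :
  box_hilbert A M d = 0 <-> forall m, in_box A m -> sumn m = d -> M m.
Proof.
split=> [/eqP|H].
  rewrite -leqn0 leqNgt -has_count => /hasPn H m mA dm.
  by have := H m; rewrite mem_layer mA dm eqxx /= negbK; apply.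
apply/eqP; rewrite -leqn0 leqNgt -has_count; apply/hasPn => m.
by rewrite mem_layer => /andP[mA /eqP dm] /=; rewrite negbK; apply: H.
Qed.

Lemma box_hilbert_lexideal_inj A M M' : lexideal A M -> lexideal A M' ->
  box_hilbert A M = box_hilbert A M' -> forall m, in_box A m -> M m = M' m.
Proof.
move=> [_ iM _] [_ iM' _] eqH m mA.
apply: (lex_initial_eq (iM (sumn m)) (iM' (sumn m))); last by rewrite mem_layer mA eqxx.
apply/eqP; rewrite -(eqn_add2r (box_hilbert A M (sumn m))) {2}eqH.
by rewrite /box_hilbert !count_predC.
Qed.

Lemma lexify_lexideal A M : sorted leq A -> all (leq 1) A -> upset A M ->
    ~~ M (origin A) ->
  lexideal A (lexify A M) /\ box_hilbert A (lexify A M) = box_hilbert A M.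
Proof.
move=> sA A_pos uM nM; have oA : origin A \in layer A 0.
  by rewrite mem_layer in_box_origin // sumn_origin.
split; first split.
- exact: clements_lindstrom.
- exact: lex_initial_lexify.
- rewrite (lexifyE M oA) (_ : count M _ = 0) //.
  apply/eqP; rewrite -leqn0 leqNgt -has_count; apply/hasPn => m.
  by rewrite mem_layer => /andP[mA /eqP /(sumn0_origin mA) ->].
apply: funext => d; have := count_predC M (layer A d).
by rewrite -(count_predC (lexify A M)) count_lexify => /addnI.
Qed.

(** * Hilbert functions of monomial ideals *)

Section Monomials.
Variables (k : fieldType) (n : nat).
Local Notation R := {mpoly k[n.+1]}.
Implicit Types (m g h : 'X_{1..n.+1}) (G : seq 'X_{1..n.+1}).

Definition expo m : seq nat := multinom_val m.

Lemma size_expo m : size (expo m) = n.+1.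
Proof. exact: size_tuple. Qed.

Lemma nth_expo m (i : 'I_n.+1) : nth 0 (expo m) i = m i.
Proof. by rewrite (mnm_nth 0). Qed.

Lemma expo_inj : injective expo.
Proof. by move=> m h eq; apply/val_inj/val_inj. Qed.

Lemma sumn_expo m : sumn (expo m) = mdeg m.
Proof. by rewrite /mdeg sumnE. Qed.

Lemma exp_le_expo g m : exp_le (expo g) (expo m) = (g <= m)%MM.
Proof.
apply/exp_le_nthP/mnm_lepP; rewrite ?size_expo // => H.
  by move=> i; rewrite -!nth_expo; apply: H.
by move=> i lt; rewrite (nth_expo g (Ordinal lt)) (nth_expo m (Ordinal lt)).
Qed.

Lemma expo_multinom s : size s = n.+1 -> exists m, expo m = s.
Proof.
by move=> /eqP sz; exists [multinom Tuple sz].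
Qed.

Lemma mpolyX_inj : injective (fun m => 'X_[k, m] : R).
Proof.
move=> m h eq; have := congr1 (mcoeff m) eq; rewrite !mcoeffX eqxx.
by case: eqP => // _ /eqP; rewrite oner_eq0.
Qed.

(** A monomial of a combination of the generators is a multiple of one of them,
which gives one direction; the other adds up the terms of p. *)
Lemma ideal_span_monomials G (p : R) :
  ideal_span [seq 'X_[k, g] : R | g <- G] p <->
  {in msupp p, forall m, has (fun g => (g <= m)%MM) G}.
Proof.
set s := [seq _ | _ <- _]; split=> [[c ->] m|H].
  rewrite mcoeff_msupp linear_sum /= => nz.
  have [i nzi] : exists i : 'I_(size s), ((c i * s`_i)@_m != 0)%R.
    apply/existsP; apply: contraNT nz => /existsPn H.
    by rewrite big1 // => i _; apply/eqP; rewrite -[_ == _]negbK.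
  have iG : i < size G by rewrite -(size_map (fun g => 'X_[k, g] : R)).
  move: nzi; rewrite (nth_map 0%MM) // -mcoeff_msupp (perm_mem (msuppMX _ _)).
  case/mapP=> h _ ->; apply/hasP; exists (nth 0%MM G i); first exact: mem_nth.
  exact: lem_addr.
have I0 : ideal_span s 0%R by exists (fun=> 0%R); rewrite big1 // => i _; rewrite mul0r.
have ID (q r : R) : ideal_span s q -> ideal_span s r -> ideal_span s (q + r)%R.
  move=> [c ->] [c' ->]; exists (fun i => c i + c' i)%R.
  by rewrite -big_split /=; apply: eq_bigr => i _; rewrite mulrDl.
have IX (c : R) g : g \in G -> ideal_span s (c * 'X_[g])%R.
  move=> gG; have lt : index g G < size s by rewrite size_map index_mem.
  exists (fun i => if i == Ordinal lt then c else 0%R).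
  rewrite (bigD1 (Ordinal lt)) //= eqxx big1 ?addr0; last first.
    by move=> i /negPf ->; rewrite mul0r.
  by rewrite (nth_map 0%MM) ?index_mem // nth_index.
rewrite [p]mpolyE big_seq; apply: big_ind => // m /H/hasP[g gG gm].
by rewrite -(submK gm) mpolyXD scalerAl; apply: IX.
Qed.

(** A space of forms described by its supports has the monomials as a basis. *)
Lemma dim_monomials d (G : seq 'X_{1..n.+1}) (V : {vspace dhomog n.+1 k d}) :
    uniq G -> all (fun m => mdeg m == d) G ->
    (forall p : dhomog n.+1 k d, p \in V <-> {subset msupp (mpoly_of_dhomog p) <= G}) ->
  \dim V = size G.
Proof.
move=> uG /allP dG VP.
pose XD m : dhomog n.+1 k d := indhomog d 'X_[m].
have valXD m : m \in G -> mpoly_of_dhomog (XD m) = 'X_[m].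
  by move=> mG; rewrite /XD /indhomog insubdK // -topredE /= dhomogX dG.
pose X := [tuple of [seq XD m | m <- in_tuple G]].
have freeX : free X.
  apply/freeP => c c0 i.
  have := congr1 (fun p : dhomog n.+1 k d =>
      (mpoly_of_dhomog p)@_(tnth (in_tuple G) i))%R c0.
  have coefZ (a : k) (x : dhomog n.+1 k d) m :
      ((mpoly_of_dhomog (a *: x))@_m = a * (mpoly_of_dhomog x)@_m)%R.
    by rewrite -mcoeffZ -linearZ.
  have coefX (j : 'I_(size G)) : ((mpoly_of_dhomog (X`_j))@_(tnth (in_tuple G) i) = (j
      == i)%:R)%R.
    rewrite -tnth_nth tnth_map valXD ?mem_tnth // mcoeffX.
    by rewrite !(tnth_nth 0%MM) nth_uniq.
  rewrite /= linear_sum /= raddf_sum /= mcoeff0 (bigD1 i) //= coefZ coefX eqxx mulr1.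
  by rewrite big1 ?addr0 // => j /negPf ji; rewrite coefZ coefX ji mulr0.
have -> : V = <<X>>%VS.
  apply/vspaceP => p; apply/idP/idP => [/VP pG|].
    have -> : p = (\sum_(m <- msupp (mpoly_of_dhomog p)) (mpoly_of_dhomog p)@_m *: XD
        m)%R.
      apply: val_inj; rewrite /= linear_sum /= [LHS]mpolyE big_seq [RHS]big_seq.
      by apply: eq_bigr => m /pG mG; rewrite valXD.
    rewrite big_seq; apply: memv_suml => m /pG mG; apply/memvZ/memv_span.
    by apply/mapP; exists m.
  move: p; apply/subvP/span_subvP => q /mapP[m mG ->]; apply/VP => h.
  by rewrite valXD // msuppX inE => /eqP ->.
by move/eqP: freeX => ->; rewrite size_tuple.
Qed.

Definition monomials d : seq 'X_{1..n.+1} :=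
    [seq s2m t | t : d.-tuple 'I_n.+1 <- enum (basis n.+1 d)].

Lemma mem_monomials d m : (m \in monomials d) = (mdeg m == d).
Proof. by rewrite basis_cover. Qed.

Lemma monomials_uniq d : uniq (monomials d).
Proof. exact: uniq_basis. Qed.

Lemma hilbert_monomials (s : seq R) (M : pred 'X_{1..n.+1}) d :
    (forall p, ideal_span s p <-> {in msupp p, forall m, M m}) ->
  hilbert (ideal_span s) d = count (predC M) (monomials d).
Proof.
move=> IM; have dB := @mem_monomials d.
rewrite /hilbert (@dim_monomials d (monomials d)) ?monomials_uniq //; first last.
- move=> p; split=> [_ m mp|_]; last exact: memvf.
  rewrite dB; apply/eqP.
  by apply: (dhomog_mf (dhomog_is_dhomog p)).
- by apply/allP => m; rewrite dB.
rewrite (@dim_monomials d [seq m <- monomials d | M m]) ?filter_uniq ?monomials_uniq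
    //; first last.
- move=> p; rewrite homog_partP IM; split=> H m mp.
    by rewrite mem_filter H //= dB; apply/eqP/(dhomog_mf (dhomog_is_dhomog p)).
  by have := H m mp; rewrite mem_filter => /andP[].
- by apply/allP => m; rewrite mem_filter dB => /andP[].
by rewrite size_filter -(count_predC M) addKn.
Qed.

Lemma hilbert_box_hilbert (A : n.+1.-tuple nat) (s : seq R) (M : pred (seq nat)) :
    (forall p, ideal_span s p <->
       {in msupp p, forall m, in_box A (expo m) ==> M (expo m)}) ->
  hilbert (ideal_span s) = box_hilbert A M.
Proof.
move=> IM; apply: funext => d; rewrite (hilbert_monomials d IM) /box_hilbert.
rewrite -!size_filter -(size_map expo); apply: perm_size; apply: uniq_perm.
- by rewrite map_inj_uniq ?filter_uniq ?monomials_uniq //; exact: expo_inj.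
- by rewrite filter_uniq ?layer_uniq.
move=> t; rewrite mem_filter mem_layer; apply/mapP/idP.
  move=> [m]; rewrite mem_filter mem_monomials /= negb_imply =>
      /andP[/andP[mA nM] /eqP <-] ->.
  by rewrite nM mA sumn_expo eqxx.
case/and3P=> nM tA /eqP dt; have [|m em] := @expo_multinom t.
  by rewrite (in_box_size tA) size_tuple.
exists m => //; rewrite mem_filter mem_monomials /= em tA /= -sumn_expo em dt eqxx andbT.
exact: nM.
Qed.

End Monomials.

(** * Minimal generators and the correspondence *)

Lemma subset_map (S T : eqType) (f : S -> T) s t : {subset t <= map f s} ->
  exists2 s', {subset s' <= s} & t = map f s'.
Proof.
elim: t => [|y t IH] H; first by exists [::].
have [|s' s's ->] := IH; first by move=> z zt; apply: H; rewrite inE zt orbT.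
have /mapP[x xs ->] := H y (mem_head _ _); exists (x :: s') => // z.
by rewrite inE => /predU1P[->|/s's].
Qed.

Section PurePowers.
Variables (k : fieldType) (n : nat) (A : n.+1.-tuple nat).
Local Notation R := {mpoly k[n.+1]}.
Implicit Types (m g h : 'X_{1..n.+1}) (G : seq 'X_{1..n.+1}).

Lemma pure_powerE (i j : 'I_n.+1) b : (U_(i) *+ b)%MM j = if i == j then b else 0.
Proof. by rewrite mulmnE mnm1E; case: eqP; rewrite ?mul1n ?mul0n. Qed.

Lemma pure_power_le (i : 'I_n.+1) b m : (U_(i) *+ b <= m)%MM = (b <= m i).
Proof.
apply/mnm_lepP/idP => [/(_ i)|bm j]; first by rewrite pure_powerE eqxx.
by rewrite pure_powerE; case: eqP => // <-.
Qed.

Lemma mdeg_pure_power (i : 'I_n.+1) b : mdeg (U_(i) *+ b)%MM = b.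
Proof. by rewrite mdegMn mdeg1 mul1n. Qed.

Lemma mem_pure_powers (B : n.+1.-tuple nat) m :
  reflect (exists i, m = (U_(i) *+ tnth B i)%MM) (m \in pure_powers B).
Proof.
apply: (iffP mapP) => [[i _ ->]|[i ->]]; first by exists i.
by exists i; rewrite ?mem_enum.
Qed.

Lemma in_box_expo m : in_box A (expo m) = [forall i, m i < tnth A i].
Proof.
apply/in_box_nthP/forallP; rewrite ?size_expo ?size_tuple // => H.
  by move=> i; rewrite -nth_expo (tnth_nth 0); apply: H.
move=> i lt; have := H (Ordinal lt).
by rewrite -nth_expo (tnth_nth 0).
Qed.

Lemma in_box_pure_power (i : 'I_n.+1) b : all (leq 1) A ->
  in_box A (expo (U_(i) *+ b)%MM) = (b < tnth A i).
Proof.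
move=> A_pos; rewrite in_box_expo; apply/forallP/idP => [/(_ i)|bA j].
  by rewrite pure_powerE eqxx.
rewrite pure_powerE; case: eqP => [<-//|_].
by have /all_tnthP/(_ j) := A_pos.
Qed.

Lemma in_box_pure_powers m :
  in_box A (expo m) = ~~ has (fun g => (g <= m)%MM) (pure_powers A).
Proof.
rewrite in_box_expo; apply/forallP/hasPn => [H g /mem_pure_powers[i ->]|H i].
  by rewrite pure_power_le -ltnNge.
rewrite ltnNge -pure_power_le; apply: H; apply/mem_pure_powers.
by exists i.
Qed.

Lemma pure_powers_mpolyX : [seq ('X_i ^+ tnth A i)%R : R | i <- enum 'I_n.+1] =
  [seq 'X_[k, m] : R | m <- pure_powers A].
Proof. by rewrite /pure_powers -map_comp; apply: eq_map => i; rewrite /= mpolyXn. Qed.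

Lemma hilbert_ci : hilbert (ci_ideal (k := k) A) = box_hilbert A pred0.
Proof.
rewrite /ci_ideal pure_powers_mpolyX; apply: hilbert_box_hilbert => p.
rewrite ideal_span_monomials; split=> H m mp; have := H m mp.
  by rewrite in_box_pure_powers => ->.
by rewrite in_box_pure_powers; case: (has _ _).
Qed.

Lemma origin_expo : expo (0%MM : 'X_{1..n.+1}) = origin A.
Proof.
apply: (@eq_from_nth _ 0); rewrite ?size_expo ?size_nseq ?size_tuple // => i lt.
by rewrite (nth_expo 0%MM (Ordinal lt)) mnm0E nth_nseq size_tuple lt.
Qed.

(** The generator 1 is excluded by minimality, since it would make the pure powers
superfluous, whose exponents are positive. *)
Lemma lpp_le_upset (I : set R) : all (leq 1) A -> is_lpp_le A I ->
  exists2 M, upset A M /\ ~~ M (origin A) & hilbert I = box_hilbert A M.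
Proof.
move=> A_pos [[B [_ B_pos [ms [[uniqG IG minG] _]]]] IA].
set G := pure_powers B ++ ms in uniqG IG minG.
pose M s := has (fun g => exp_le (expo g) s) G.
have ME m : M (expo m) = has (fun g => (g <= m)%MM) G.
  by apply: eq_has => g; rewrite exp_le_expo.
exists M; first split.
- by move=> s t _ st /hasP[g gG gs]; apply/hasP; exists g => //;
    exact: exp_le_trans gs st.
- rewrite -origin_expo ME; apply/hasP => -[g gG g0].
  have {}g0 : g = 0%MM.
    by apply/mnmP => i; have /mnm_lepP/(_ i) := g0; rewrite !mnm0E leqn0 => /eqP.
  have G1 : {subset [:: (1 : R)%R] <= [seq 'X_[k, m] : R | m <- G]}.
    move=> p; rewrite inE => /eqP ->; apply/mapP; exists 0%MM; last by rewrite mpolyX0.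
    by rewrite -g0.
  have /minG : ideal_span [:: (1 : R)%R] = I.
    rewrite IG -mpolyX0; apply/seteqP; split=> p _; last first.
      by apply/(@ideal_span_monomials k n [:: 0%MM]) => m _; rewrite /= orbF;
          apply/mnm_lepP => i; rewrite mnm0E.
    apply/ideal_span_monomials => m _; apply/hasP; exists g => //.
    by rewrite g0; apply/mnm_lepP => i; rewrite mnm0E.
  move=> /(_ G1 ('X_[U_(ord0) *+ tnth B ord0] : R)); rewrite map_f; last first.
    by rewrite mem_cat; apply/orP; left; apply/mem_pure_powers; exists ord0.
  move=> /(_ isT); rewrite inE -mpolyX0 => /eqP/mpolyX_inj/(congr1 mdeg).
  rewrite mdeg_pure_power mdeg0 => B0.
  by have /all_tnthP/(_ ord0) := B_pos; rewrite B0.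
rewrite IG; apply: hilbert_box_hilbert => p; rewrite ideal_span_monomials.
split=> H m mp; first by rewrite ME H // implybT.
have := H m mp; rewrite ME; have [//|] := boolP (in_box A (expo m)).
rewrite in_box_pure_powers negbK => /hasP[_ /mem_pure_powers[i ->] le] _.
have := IA i; rewrite IG mpolyXn => /ideal_span_monomials/(_ (U_(i) *+ tnth A i)%MM).
rewrite msuppX inE eqxx => /(_ isT)/hasP[g gG gA].
by apply/hasP; exists g => //; exact: lepm_trans gA le.
Qed.

End PurePowers.

Section MinimalGenerators.
Variables (k : fieldType) (n : nat) (A : n.+1.-tuple nat) (M : pred (seq nat)).
Hypotheses (A_pos : all (leq 1) A) (A_sorted : sorted leq A) (lexM : lexideal A M).
Local Notation R := {mpoly k[n.+1]}.
Implicit Types (m g h : 'X_{1..n.+1}) (G : seq 'X_{1..n.+1}).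

(** Membership in the ideal of the monomials of M and of those outside the box. *)
Definition in_ideal m := in_box A (expo m) ==> M (expo m).

Lemma in_ideal_le g m : (g <= m)%MM -> in_ideal g -> in_ideal m.
Proof.
rewrite -exp_le_expo => gm /implyP Dg; apply/implyP => mA.
by have [upM _ _] := lexM; apply: upM mA gm (Dg (exp_le_in_box gm mA)).
Qed.

Lemma in_ideal0 : ~~ in_ideal 0%MM.
Proof.
by have [_ _ nM] := lexM; rewrite /in_ideal (origin_expo A) in_box_origin.
Qed.

Definition minimal_monomial m := in_ideal m && [forall i, (0 < m i) ==> ~~ in_ideal (m
    - U_(i))%MM].

(** A proper divisor of g divides g / x_i for some i. *)
Lemma minimal_monomial_eq g h : minimal_monomial g -> in_ideal h -> (h <= g)%MM -> h = g.
Proof.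
move=> /andP[_ /forallP ming] Dh /mnm_lepP hg; apply/mnmP => i.
apply/eqP; rewrite eqn_leq hg leqNgt; apply/negP => lt.
have /implyP := ming i; case/(_ (leq_ltn_trans _ lt))/negP => //.
apply: in_ideal_le Dh; apply/mnm_lepP => j; rewrite mnmBE mnm1E.
by case: eqP => [<-|_]; rewrite ?subn0 ?hg //; lia.
Qed.

Lemma exists_minimal m : in_ideal m -> exists2 g, minimal_monomial g & (g <= m)%MM.
Proof.
have [d] := ubnP (mdeg m); elim: d m => // d IH m; rewrite ltnS => md Dm.
have [minm|] := boolP (minimal_monomial m); first by exists m; rewrite ?lepm_refl.
rewrite /minimal_monomial Dm negb_forall => /existsP[i];
    rewrite negb_imply negbK => /andP[mi Dmi].
have [|g ming gm] := IH (m - U_(i))%MM _ Dmi; last first.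
  by exists g => //; exact: lepm_trans gm (lem_subr _ _).
have le : (U_(i) <= m)%MM by apply/mnm_lepP => j; rewrite mnm1E; case: eqP => [<-|].
by have := congr1 mdeg (submK le); rewrite mdegD mdeg1; lia.
Qed.

Lemma in_ideal_pure_power (i : 'I_n.+1) : in_ideal (U_(i) *+ tnth A i)%MM.
Proof. by rewrite /in_ideal in_box_pure_power // ltnn. Qed.

Lemma minimal_monomial_mdeg g : minimal_monomial g -> mdeg g < (sumn A).+1.
Proof.
move=> ming; rewrite ltnS -sumn_expo; apply: exp_le_sumn; apply/exp_le_nthP.
  by rewrite size_expo size_tuple.
rewrite size_expo => i lt; rewrite (nth_expo g (Ordinal lt)) leqNgt; apply/negP => ltA.
have := @minimal_monomial_eq g (U_(Ordinal lt) *+ tnth A (Ordinal lt))%MM ming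
    (in_ideal_pure_power _).
rewrite pure_power_le (tnth_nth 0) => /(_ (ltnW ltA)) eg.
by move: ltA; rewrite -eg pure_powerE eqxx ltnn.
Qed.

Fact pure_exponent_ex (i : 'I_n.+1) : exists b, in_ideal (U_(i) *+ b)%MM.
Proof. by exists (tnth A i); exact: in_ideal_pure_power. Qed.

(** The exponents b_i: x_i^(b_i) is the least power of x_i in the ideal. *)
Definition pure_exponents : n.+1.-tuple nat :=
    [tuple ex_minn (pure_exponent_ex i) | i < n.+1].
Local Notation B := pure_exponents.

Lemma pure_exponentP (i : 'I_n.+1) : in_ideal (U_(i) *+ tnth B i)%MM /\
  (forall b, in_ideal (U_(i) *+ b)%MM -> tnth B i <= b).
Proof. by rewrite tnth_mktuple; case: ex_minnP. Qed.

Lemma pure_exponent_gt0 (i : 'I_n.+1) : 0 < tnth B i.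
Proof.
rewrite lt0n; apply/eqP => B0; have [] := pure_exponentP i; rewrite B0 mulm0n.
by move=> D0; case/negP: in_ideal0.
Qed.

Lemma minimal_pure_power (i : 'I_n.+1) : minimal_monomial (U_(i) *+ tnth B i)%MM.
Proof.
have [DB minB] := pure_exponentP i; rewrite /minimal_monomial DB; apply/forallP => j;
    apply/implyP.
rewrite pure_powerE; case: eqP => // <- B_gt0; apply/negP.
have -> : (U_(i) *+ tnth B i - U_(i))%MM = (U_(i) *+ (tnth B i).-1)%MM.
  by apply/mnmP => l; rewrite mnmBE !pure_powerE mnm1E; case: eqP => // _; rewrite subn1.
by move=> /minB; rewrite leqNgt ltn_predL B_gt0.
Qed.

(** If b_j < b_i with i < j, then b_j < a_i <= a_j, so x_j^(b_j) and the larger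
monomial x_i^(b_j) are both in the box and the latter is in M. *)
Lemma pure_exponents_sorted : sorted leq B.
Proof.
apply/(sortedP 0) => i; rewrite size_tuple => lt.
pose x : 'I_n.+1 := Ordinal (ltnW lt); pose y : 'I_n.+1 := Ordinal lt.
rewrite -[i.+1]/(val y) -[i]/(val x) -!tnth_nth leqNgt; apply/negP => ltB.
have [_ minx] := pure_exponentP x; have [Dy _] := pure_exponentP y.
have leA : tnth A x <= tnth A y.
  rewrite !(tnth_nth 0); move/(sortedP 0): A_sorted; apply.
  by rewrite size_tuple.
have ltx : tnth B y < tnth A x by apply: leq_trans ltB (minx _ (in_ideal_pure_power x)).
suff /minx : in_ideal (U_(x) *+ tnth B y)%MM by rewrite leqNgt ltB.
rewrite /in_ideal; apply/implyP => xA; have yA : in_box A (expo (U_(y) *+ tnth B y)%MM).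
  by rewrite in_box_pure_power //; exact: leq_trans ltx leA.
apply: (lexideal_initial lexM yA xA); last exact: (implyP Dy yA).
  by rewrite !sumn_expo !mdeg_pure_power.
apply: (@lexlt_nth x); rewrite ?size_expo //.
  move=> j ji; have jn : j < n.+1 := ltn_trans ji (ltn_ord x).
  rewrite (nth_expo _ (Ordinal jn)) (nth_expo (U_(x) *+ _)%MM (Ordinal jn)) !pure_powerE.
  by rewrite -!val_eqE /= !gtn_eqF // (ltn_trans ji).
rewrite !nth_expo !pure_powerE eqxx -val_eqE /= gtn_eqF //.
exact: pure_exponent_gt0.
Qed.

(** Minimal monomials have degree at most the sum of the a_i, whence the bound. *)
Definition other_generators : seq 'X_{1..n.+1} :=
  [seq g <- [seq bmnm m | m : 'X_{1..n.+1 < (sumn A).+1}] |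
     minimal_monomial g && (g \notin pure_powers B)].
Local Notation G := (pure_powers B ++ other_generators).

Lemma mem_generators g : (g \in G) = minimal_monomial g.
Proof.
rewrite mem_cat mem_filter; apply/orP/idP =>
    [[/mem_pure_powers[i ->]|/andP[/andP[]//]]|ming].
  exact: minimal_pure_power.
have [gP|gP] := boolP (g \in pure_powers B); [by left|right].
rewrite ming /=; apply/mapP; exists (BMultinom (minimal_monomial_mdeg ming)) => //.
by rewrite mem_enum.
Qed.

Lemma generators_uniq : uniq G.
Proof.
rewrite cat_uniq filter_uniq ?andbT; last first.
  by rewrite map_inj_uniq ?enum_uniq //; exact: val_inj.
apply/andP; split; last first.
  by apply/hasPn => g; rewrite mem_filter => /andP[/andP[]].
rewrite map_inj_uniq ?enum_uniq // => i j eqU.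
have := congr1 (fun m : 'X_{1..n.+1} => m i) eqU.
rewrite /= !pure_powerE eqxx; case: (eqVneq j i) => // _ B0.
by have := pure_exponent_gt0 i; rewrite B0.
Qed.

Lemma divisible_generators m : has (fun g => (g <= m)%MM) G = in_ideal m.
Proof.
apply/hasP/idP => [[g]|/exists_minimal[g ming gm]]; last by exists g;
    rewrite ?mem_generators.
by rewrite mem_generators => /andP[Dg _] gm; exact: in_ideal_le gm Dg.
Qed.

(** A minimal monomial outside the box is divisible by some x_i^(a_i), hence by
x_i^(b_i). *)
Lemma minimal_monomial_in_box g : minimal_monomial g -> g \notin pure_powers B ->
    in_box A (expo g).
Proof.
move=> ming; apply: contraNT; rewrite in_box_expo negb_forall => /existsP[i].
rewrite -leqNgt => Ai; apply/mem_pure_powers; exists i.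
have [DB minB] := pure_exponentP i; apply/esym/minimal_monomial_eq => //.
by rewrite pure_power_le (leq_trans _ Ai) // minB // in_ideal_pure_power.
Qed.

Definition monomial_ideal : set R := ideal_span [seq 'X_[k, m] : R | m <- G].

Lemma monomial_idealP (p : R) :
  monomial_ideal p <-> {in msupp p, forall m, in_ideal m}.
Proof.
rewrite /monomial_ideal ideal_span_monomials.
by split=> H m /H; rewrite divisible_generators.
Qed.

Lemma monomial_idealX m : monomial_ideal 'X_[m] <-> in_ideal m.
Proof.
rewrite monomial_idealP; split=> [|Dm h]; first by apply; rewrite msuppX inE.
by rewrite msuppX inE => /eqP ->.
Qed.

(** The generators other than pure powers are in the box, where the lexicographic
condition is that of M. *)
Lemma monomial_ideal_lpp : is_lpp_le A monomial_ideal.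
Proof.
split; last by move=> i; rewrite mpolyXn; apply/monomial_idealX/in_ideal_pure_power.
exists B; split; first exact: pure_exponents_sorted.
  by apply/all_tnthP => i; exact: pure_exponent_gt0.
exists other_generators; split; last first.
  move=> m m'; rewrite mem_filter => /andP[/andP[minm mB] _] dm lt.
  apply/monomial_idealX/implyP => m'A; have mA := minimal_monomial_in_box minm mB.
  apply: (lexideal_initial lexM mA m'A); rewrite ?sumn_expo //.
  by move: minm => /andP[/implyP Dm _]; exact: Dm.
split=> //.
  by rewrite map_inj_uniq ?generators_uniq //; exact: mpolyX_inj.
move=> t /subset_map[G' G'G ->] spanG' p /mapP[g gG ->].
have ming : minimal_monomial g by rewrite -mem_generators.
have : monomial_ideal 'X_[g] by apply/monomial_idealX; case/andP: ming.
rewrite -spanG' => /ideal_span_monomials/(_ g);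
    rewrite msuppX inE eqxx => /(_ isT)/hasP[h hG' hg].
rewrite map_f // -(minimal_monomial_eq ming _ hg) //.
by have := G'G h hG'; rewrite mem_generators => /andP[].
Qed.

Lemma hilbert_monomial_ideal : hilbert monomial_ideal = box_hilbert A M.
Proof. by apply: hilbert_box_hilbert => p; exact: monomial_idealP. Qed.

End MinimalGenerators.

Lemma min_natP (P : pred nat) (o : option nat) :
    (if o is Some a then P a /\ (forall i, P i -> a <= i) else forall i, ~~ P i) ->
  min_nat P = o.
Proof.
rewrite /min_nat; case: pselect => [exP|nP]; case: o => [a|] //=.
- case=> Pa minP; congr Some; case: ex_minnP => b Pb minb.
  by apply/eqP; rewrite eqn_leq minb ?minP.
- by move=> noP; case: exP => i Pi; move/negP: (noP i).
- by case=> Pa _; case: nP; exists a.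
Qed.

Theorem theorem7 (k : fieldType) (n : nat) (A : n.+1.-tuple nat)
    (A_pos : all (leq 1) A) (A_sorted : sorted leq A) :
  exists Phi : nvec n -> (nat -> nat),
    set_bij [set T : nvec n | is_lpp_vec A T]
            [set H : nat -> nat |
              exists2 I : set {mpoly k[n.+1]}, is_lpp_le A I & H = hilbert I]
            Phi
    /\ forall T : nvec n, is_lpp_vec A T ->
         vec_alpha A T = hilbert_alpha k A (Phi T)
         /\ Some (vec_sigma A T) = hilbert_sigma (Phi T).
Proof.
have sA : size A = n.+1 by rewrite size_tuple.
exists (fun T => box_hilbert A (vec_ideal T)); split; first split.
- move=> T /= lppT; have [lexT _ _ _] := vec_ideal_spec sA A_pos lppT.
  exists (monomial_ideal (vec_ideal T) A_pos); first exact: monomial_ideal_lpp.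
  by rewrite hilbert_monomial_ideal.
- move=> T T'; rewrite !inE /= => lppT lppT' eqH.
  have [lexT _ _ _] := vec_ideal_spec sA A_pos lppT;
      have [lexT' _ _ _] := vec_ideal_spec sA A_pos lppT'.
  by apply: (vec_ideal_inj sA A_pos lppT lppT'); exact: box_hilbert_lexideal_inj.
- move=> H [I lppI ->]; have [M [upM nM] ->] := lpp_le_upset A_pos lppI.
  have [lexL eqL] := lexify_lexideal A_sorted A_pos upM nM.
  have [T lppT eqT] := vec_ideal_surj sA A_pos A_sorted lexL.
  exists T => //; rewrite -eqL; apply: funext => d; apply: eq_in_count => m.
  by rewrite mem_layer => /andP[mA _] /=; rewrite eqT.
move=> T lppT; have [_ minT [fullT [t [tA nt dt]]] _] := vec_ideal_spec sA A_pos lppT.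
split; apply/esym/min_natP.
  have ciE i : hilbert (ci_ideal (k := k) A) i = size (layer A i).
    by rewrite hilbert_ci /box_hilbert (eq_count (a2 := predT)) ?count_predT.
  case: (vec_alpha A T) minT => [a [[m [mA Mm dm]] mina]|noM].
    split; first by rewrite ciE; apply/box_hilbert_alpha; exists m.
    by move=> i; rewrite ciE => /box_hilbert_alpha[v [vA Mv <-]]; exact: mina.
  by move=> i; rewrite ciE; apply/negP => /box_hilbert_alpha[v [vA Mv _]];
      move/negP: (noM v vA).
split; first by apply/eqP/box_hilbert_eq0 => m mA dm; apply: fullT; rewrite ?dm.
move=> i /eqP/box_hilbert_eq0 H; rewrite leqNgt; apply/negP => lt.
have le : i <= sumn t by lia.
case/negP: nt; have [v vt dv] := exp_le_of_degree le.
have [upT _ _] : lexideal A (vec_ideal T) by have [] := vec_ideal_spec sA A_pos lppT.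
by apply: (upT v) => //; apply: H => //; exact: exp_le_in_box vt tA.
Qed.
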